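(* Suppose that a group $\Gamma=\Gamma_1\times \Gamma_2$ acts geometrically on a CAT(0) space $X$. If $\Gamma_1$ acts cocompactly on the convex hull $C(\Gamma_1 x_0)$ of some $\Gamma_1$-orbit $\Gamma_1 x_0$ ($x_0\in X$), then there exists a closed, convex, $\Gamma$-invariant, quasi-dense subspace $X'\subset X$ such that $X'$ splits as a product $X_1 \times X_2$, $\Gamma_1$ naturally acts geometrically on $X_1$ (by restriction), and $\Gamma_2$ acts geometrically on $X_2$ by projection. Here each subspace of the form $X_1\times \{x_2\}$ (with $x_2\in X_2$) is the closed convex hull of some $\Gamma_1$-orbit.
   Context: A geometric action of a group $\Gamma$ on a CAT(0) space $X$ is an action by isometries that is proper (every $x\in X$ has some $r>0$ such that $\{\gamma\in\Gamma : \gamma B(x,r)\cap B(x,r)\ne\emptyset\}$ is finite) and cocompact (there is a compact $K\subset X$ with $\Gamma K=X$). The subgroups $\Gamma_1,\Gamma_2$ of $\Gamma_1\times\Gamma_2$ act on $X$ by restricting the $\Gamma$-action. $C(\Gamma_1x_0)$ denotes the closed convex hull of the orbit $\Gamma_1x_0$ in $X$. A subset $X'$ of a metric space $X$ is quasi-dense if there is $N>0$ such that each point of $X$ is within distance $N$ of some point of $X'$. ''$X'$ splits as a product $X_1\times X_2$'' means that $X'$ is isometric to $X_1\times X_2$ with the $\ell^2$ product metric $d((x_1,x_2),(y_1,y_2))^2=d(x_1,y_1)^2+d(x_2,y_2)^2$; each factor may be identified with a slice ($X_1\times\{x_2\}$ or $\{x_1\}\times X_2$) of the product. $\Gamma_1$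 acts geometrically on $X_1$ by restriction: $X_1$ (as a slice in $X$) is $\Gamma_1$-invariant and the restriction of the original action to $\Gamma_1$ and $X_1$ is geometric. $\Gamma_2$ acts geometrically on $X_2$ by projection: with $p_2:X_1\times X_2\to X_2$ the projection and $X_2$ identified with a slice, the formula $\gamma_2 * x_2=p_2(\gamma_2\cdot x_2)$, where $\cdot$ is the original action, defines an action of $\Gamma_2$ on $X_2$ and this action is geometric. *)

(* Defs.v *)
(* MathComp-Analysis: metric spaces are [metricType R] over [R : realType];
   possibly infinite groups are [groupType]. *)
From HB Require Import structures.
From mathcomp Require Import all_boot all_order all_algebra all_fingroup.
From mathcomp Require Import all_classical all_reals all_analysis.

Set Implicit Arguments.
Unset Strict Implicit.
Unset Printing Implicit Defensive.
Import Order.TTheory GRing.Theory Num.Theory.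
Local Open Scope classical_set_scope.
Local Open Scope ring_scope.

Section CAT0Spaces.
Context {R : realType} {X : metricType R}.

Definition geodesic_segment (x y : X) (S : set X) : Prop :=
  exists c : R -> X,
    [/\ c 0 = x, c (mdist x y) = y,
        {in `[0, mdist x y] &, forall s t, mdist (c s) (c t) = `|s - t|} &
        S = c @` `[0, mdist x y]].

(* The library norm on ['rV[R]_2] is the sup norm, hence this definition. *)
Definition euclid_dist (u v : 'rV[R]_2) : R :=
  Num.sqrt (\sum_i (u 0 i - v 0 i) ^+ 2).

(* [x'] on the Euclidean segment [p', q'] is the comparison point of the point
   [x] of the side [S] from [p] to [q]. *)
Definition comparison_point (p : X) (S : set X) (p' q' : 'rV[R]_2)
    (x : X) (x' : 'rV[R]_2) : Prop :=
  [/\ S x,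
      exists2 t : R, 0 <= t <= 1 & x' = (1 - t) *: p' + t *: q' &
      euclid_dist p' x' = mdist p x].

Definition CAT0_inequality : Prop :=
  forall (p q r : X) (Spq Sqr Srp : set X) (p' q' r' : 'rV[R]_2),
    geodesic_segment p q Spq -> geodesic_segment q r Sqr ->
    geodesic_segment r p Srp ->
    euclid_dist p' q' = mdist p q -> euclid_dist q' r' = mdist q r ->
    euclid_dist r' p' = mdist r p ->
    let cmp x x' :=
      [\/ comparison_point p Spq p' q' x x',
          comparison_point q Sqr q' r' x x' |
          comparison_point r Srp r' p' x x'] in
    forall x y x' y', cmp x x' -> cmp y y' -> mdist x y <= euclid_dist x' y'.

(* Intended for subsets of a geodesic space, where geodesic segments between
   any two points exist. *)
Definition geodesically_convex (C : set X) : Prop :=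
  forall x y S, C x -> C y -> geodesic_segment x y S -> S `<=` C.

Definition closed_convex_hull (A : set X) : set X :=
  smallest [set C | closed C /\ geodesically_convex C] A.

Definition quasi_dense (A : set X) : Prop :=
  exists2 N : R, 0 < N & forall x, exists2 y, A y & mdist x y <= N.

End CAT0Spaces.

(* Completeness is not part of the definition. *)
Definition CAT0 {R : realType} (X : metricType R) : Prop :=
  (forall x y : X, exists S, geodesic_segment x y S) /\ @CAT0_inequality R X.

Section Actions.
Context {R : realType} {G : groupType} {X : metricType R}.
Implicit Types (act : G -> X -> X) (S : set X).

Definition orbit_set act (x : X) : set X := range (act^~ x).

Definition invariant_set act S : Prop := forall g x, S x -> S (act g x).

Definition cocompact_on act S : Prop :=
  exists K : set X,
    [/\ compact K, K `<=` S & \bigcup_(g in [set: G]) (act g @` K) = S].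

(* [act] may be an arbitrary function outside [S]; balls are those of the
   metric subspace [S]. *)
Definition proper_on act S : Prop :=
  forall x, S x -> exists2 r : R, 0 < r &
    finite_set [set g | (act g @` (ball x r `&` S)) `&` (ball x r `&` S)
                          !=set0].

Record geometric_action_on act S : Prop := GeometricActionOn {
  geometric_invariant : invariant_set act S ;
  geometric_act1 : forall x, S x -> act 1%g x = x ;
  geometric_actM : forall g h x, S x -> act (g * h)%g x = act g (act h x) ;
  geometric_isometric : forall g x y, S x -> S y ->
    mdist (act g x) (act g y) = mdist x y ;
  geometric_proper : proper_on act S ;
  geometric_cocompact : cocompact_on act S
}.

End Actions.

Section ProductGroups.
Context {G1 G2 : groupType} {T : Type}.

Definition act_left (act : G1 * G2 -> T -> T) : G1 -> T -> T :=
  fun g => act (g, 1%g).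

Definition act_right (act : G1 * G2 -> T -> T) : G2 -> T -> T :=
  fun g => act (1%g, g).

End ProductGroups.

Section Products.
Context {R : realType} {X X1 X2 : metricType R}.

(* The library distance on a product type is the sup distance. *)
Definition l2_dist (u v : X1 * X2) : R :=
  Num.sqrt (mdist u.1 v.1 ^+ 2 + mdist u.2 v.2 ^+ 2).

(* [f] is an isometry from the l2 product onto [X'], and [p] inverts it on
   [X']: the values of [p] outside [X'] are irrelevant. *)
Definition product_splitting (X' : set X) (f : X1 * X2 -> X)
    (p : X -> X1 * X2) : Prop :=
  [/\ forall u v, mdist (f u) (f v) = l2_dist u v, range f = X' & cancel f p].

Definition slice (f : X1 * X2 -> X) (x2 : X2) : set X :=
  range (fun x1 => f (x1, x2)).

(* [g * x2 = p2 (g . x2)], with [X2] identified with the slice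
   [{x1} x X2]. *)
Definition projected_action (G : groupType) (act : G -> X -> X)
    (f : X1 * X2 -> X) (p : X -> X1 * X2) (x1 : X1) : G -> X2 -> X2 :=
  fun g x2 => (p (act g (f (x1, x2)))).2.

End Products.

(* Main.v *)
Require Import Defs.
From HB Require Import structures.
From mathcomp Require Import all_boot all_order all_algebra all_fingroup.
From mathcomp Require Import all_classical all_reals all_analysis.
From mathcomp Require Import ring lra.

(** The space [X'] is the union of all minimal nonempty closed convex
    [G1]-invariant sets.  Minimal sets exist, by Zorn's lemma, because [G1] is
    cocompact on the hull of an orbit ([minimal_ex]).

    Everything is deduced from Stewart's inequality in a CAT(0) space
    ([stewart_le]).  It makes nearest-point projections onto closed convex sets
    well defined and 1-Lipschitz; the completeness that this requires comes from
    the proper cocompact action ([geometric_complete]).  A convex continuous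
    [G1]-invariant function on a minimal set is constant, since its sublevel sets
    would otherwise contradict minimality ([minimal_constant]).  Applied to the
    distance to another minimal set [N], this shows that the projections between
    two minimal sets [M] and [N] are mutually inverse isometries, and that [M]
    and [N] bound a metric product of [M] with an interval
    ([minimal_pythagoras]).

    For these strips to fit together into a product, the projection from [M1] to
    [M3] must agree with the projection through any [M2].  The composition
    around a triangle of minimal sets is a [G1]-equivariant isometry of [M1]
    whose displacement is constant, again by minimality, hence a Clifford
    translation.  Going around the triangle along a long piece of an axis
    rules out a positive displacement ([no_holonomy]).

    Fix a minimal set [C] and a point [c0] of it.  The pair of [c] in [C] and of
    [z] in the fibre of the projection to [C] over [c0] is sent to the projection
    of [c] to the minimal set through [z]; the Pythagorean identity says that
    this is an isometry for the l2 metric ([split_map_isometry]).  The union is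
    convex because the slices of a strip between two minimal sets are again
    minimal ([minimal_union_convex]), and closed because a limit of minimal sets
    is the image of an equivariant isometric embedding of [C]
    ([minimal_union_closed]).

    Since [G2] commutes with [G1], it permutes the minimal sets, so it acts on the
    second factor.  An element of [G2] that moves a point of the second factor
    little can be corrected by an element of [G1], which is cocompact on [C], so
    as to keep a given point of [X] near a compact set; properness of the
    projected action follows from that of the whole action
    ([projected_action_geometric]). *)

Set Implicit Arguments.
Unset Strict Implicit.
Unset Printing Implicit Defensive.
Import Order.TTheory GRing.Theory Num.Theory.
Local Open Scope classical_set_scope.
Local Open Scope ring_scope.

(** * Plane comparison triangles *)

Section Plane.
Context {R : realType}.
Implicit Types a b c d t : R.

Definition vec2 a b : 'rV[R]_2 := \row_(i < 2) (if i == ord0 then a else b).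

Lemma euclid_dist_vec2 a b c d :
  euclid_dist (vec2 a b) (vec2 c d) = Num.sqrt ((a - c) ^+ 2 + (b - d) ^+ 2).
Proof. by rewrite /euclid_dist !big_ord_recl big_ord0 !mxE/= addr0. Qed.

Lemma vec2_segment t a b c d :
  (1 - t) *: vec2 a b + t *: vec2 c d =
  vec2 ((1 - t) * a + t * c) ((1 - t) * b + t * d).
Proof. by apply/rowP => i; rewrite !mxE; case: ifP. Qed.

Lemma sqrt_eq (x y : R) : 0 <= y -> x = y ^+ 2 -> Num.sqrt x = y.
Proof. by move=> y0 ->; rewrite sqrtr_sqr ger0_norm. Qed.

(** The apex has coordinates [(u, v)], with [u] given by the law of cosines. *)
Lemma plane_apex a b c : 0 <= a -> 0 <= b -> 0 <= c ->
  a <= b + c -> b <= a + c -> c <= a + b ->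
  exists u v : R, [/\ u ^+ 2 + v ^+ 2 = b ^+ 2,
    (u - a) ^+ 2 + v ^+ 2 = c ^+ 2 & 2 * a * u = a ^+ 2 + b ^+ 2 - c ^+ 2].
Proof.
move=> a0 b0 c0 abc bac cab.
have [a_eq0|a_neq0] := eqVneq a 0.
  have bc : b = c by apply/eqP; rewrite eq_le; apply/andP; split; lra.
  by exists b, 0; rewrite a_eq0 bc; split; ring.
have a_gt0 : 0 < a by rewrite lt_def a_neq0.
pose u := (a ^+ 2 + b ^+ 2 - c ^+ 2) / (2 * a).
have uE : 2 * a * u = a ^+ 2 + b ^+ 2 - c ^+ 2 by rewrite /u; field.
have ub : u <= b by rewrite -(ler_pM2l (_ : 0 < 2 * a)) ?uE; nra.
have ub' : - b <= u by rewrite -(ler_pM2l (_ : 0 < 2 * a)) ?uE; nra.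
have v0 : 0 <= b ^+ 2 - u ^+ 2 by nra.
exists u, (Num.sqrt (b ^+ 2 - u ^+ 2)); rewrite sqr_sqrtr//.
split=> //; first by ring.
have -> : (u - a) ^+ 2 + (b ^+ 2 - u ^+ 2) = a ^+ 2 + b ^+ 2 - 2 * a * u by ring.
by rewrite uE; ring.
Qed.

End Plane.

(** * Geodesics of a CAT(0) space *)

Section Geodesics.
Context {R : realType} {X : metricType R}.
Hypothesis catX : CAT0 X.
Implicit Types (x y z p q : X) (s t : R).

Lemma geodesic_ex x y : exists c : R -> X,
  [/\ c 0 = x, c (mdist x y) = y &
    {in `[0, mdist x y] &, forall s t, mdist (c s) (c t) = `|s - t|}].
Proof. by have [S [c []]] := catX.1 x y; exists c. Qed.

(** The point dividing the segment from [x] to [y] in the ratio [t : 1 - t]. *)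
Definition geopt x y t : X := sval (cid (geodesic_ex x y)) (t * mdist x y).

Lemma itv_scale t (a : R) : 0 <= a -> 0 <= t <= 1 -> t * a \in `[0, a].
Proof. by move=> a0 /andP[t0 t1]; rewrite in_itv/= mulr_ge0//= ler_piMl. Qed.

Lemma geopt_segment x y : exists S,
  geodesic_segment x y S /\ forall t, 0 <= t <= 1 -> S (geopt x y t).
Proof.
rewrite /geopt; case: cid => c /= [c0 c1 ci].
exists (c @` `[0, mdist x y]); split; first by exists c; split.
move=> t t01; exists (t * mdist x y) => //.
exact: itv_scale (mdist_ge0 _ _) t01.
Qed.

Lemma mdist_geoptl x y t : 0 <= t <= 1 -> mdist x (geopt x y t) = t * mdist x y.
Proof.
rewrite /geopt; case: cid => c /= [c0 c1 ci] t01.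
rewrite -[X in mdist X _]c0 ci ?itv_scale ?mdist_ge0//.
  by case/andP: t01 => t0 t1; rewrite sub0r normrN ger0_norm// mulr_ge0 ?mdist_ge0.
by rewrite in_itv/= lexx mdist_ge0.
Qed.

Lemma mdist_geoptr x y t :
  0 <= t <= 1 -> mdist (geopt x y t) y = (1 - t) * mdist x y.
Proof.
rewrite /geopt; case: cid => c /= [c0 c1 ci] t01.
rewrite -[X in mdist _ X]c1 ci ?itv_scale ?mdist_ge0//; last first.
  by rewrite in_itv/= lexx mdist_ge0.
rewrite distrC -[X in X - _]mul1r -mulrBl ger0_norm//.
by case/andP: t01 => t0 t1; rewrite mulr_ge0 ?mdist_ge0// subr_ge0.
Qed.

(** The CAT(0) inequality for a vertex and a point of the opposite side, written
    out with Stewart's theorem in the comparison triangle. *)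
Lemma stewart_le p x y t : 0 <= t <= 1 ->
  mdist p (geopt x y t) ^+ 2 <= (1 - t) * mdist p x ^+ 2 + t * mdist p y ^+ 2
                                - t * (1 - t) * mdist x y ^+ 2.
Proof.
move=> t01; have /andP[t0 t1] := t01.
have a0 := mdist_ge0 x y; have b0 := mdist_ge0 p x; have c0 := mdist_ge0 p y.
have [u [v [buv cuv uE]]] : exists u v : R,
    [/\ u ^+ 2 + v ^+ 2 = mdist p x ^+ 2,
        (u - mdist x y) ^+ 2 + v ^+ 2 = mdist p y ^+ 2 &
        2 * mdist x y * u = mdist x y ^+ 2 + mdist p x ^+ 2 - mdist p y ^+ 2].
  apply: plane_apex => //.
  - by rewrite [mdist p x]metric_sym metric_triangle.
  - by rewrite addrC [mdist x y]metric_sym metric_triangle.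
  - by rewrite addrC metric_triangle.
have [Sxy [gxy Sxyt]] := geopt_segment x y.
have [Spx gpx] := catX.1 p x; have [Syp gyp] := catX.1 y p.
have pSpx : Spx p.
  by case: gpx => c [c0' _ _ ->]; exists 0 => //=; rewrite in_itv/= lexx.
have h1 : euclid_dist (vec2 u v) (vec2 0 0) = mdist p x.
  by rewrite euclid_dist_vec2; apply: sqrt_eq => //; rewrite -buv; ring.
have h2 : euclid_dist (vec2 0 0) (vec2 (mdist x y) 0) = mdist x y.
  by rewrite euclid_dist_vec2; apply: sqrt_eq => //; ring.
have h3 : euclid_dist (vec2 (mdist x y) 0) (vec2 u v) = mdist y p.
  rewrite [RHS]metric_sym euclid_dist_vec2; apply: sqrt_eq => //.
  by rewrite -cuv; ring.
have cmp_p : comparison_point p Spx (vec2 u v) (vec2 0 0) p (vec2 u v).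
  split=> //; last by rewrite mdistxx euclid_dist_vec2 !subrr expr0n/= addr0 sqrtr0.
  by exists 0; rewrite ?lexx ?ler01// subr0 scale1r scale0r addr0.
have cmp_z : comparison_point x Sxy (vec2 0 0) (vec2 (mdist x y) 0)
    (geopt x y t) (vec2 (t * mdist x y) 0).
  split; first exact: Sxyt.
    by exists t => //; rewrite vec2_segment !mulr0 !add0r.
  rewrite euclid_dist_vec2 mdist_geoptl//; apply: sqrt_eq; first exact: mulr_ge0.
  by ring.
have := catX.2 p x y Spx Sxy Syp _ _ _ gpx gxy gyp h1 h2 h3 p (geopt x y t) _ _
  (Or31 _ _ cmp_p) (Or32 _ _ cmp_z).
rewrite euclid_dist_vec2 -(ler_pXn2r (_ : 0 < 2)%N) ?nnegrE ?mdist_ge0 ?sqrtr_ge0//.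
rewrite sqr_sqrtr ?addr_ge0 ?sqr_ge0//; move/le_trans; apply.
have := congr1 (fun w => t * w) uE; rewrite -buv -cuv => {}uE.
by rewrite le_eqVlt; apply/orP; left; apply/eqP; ring.
Qed.

Lemma mdist_le_sqr (x y z w : X) :
  mdist x y ^+ 2 <= mdist z w ^+ 2 -> mdist x y <= mdist z w.
Proof. by rewrite ler_pXn2r ?nnegrE ?mdist_ge0. Qed.

Lemma mdist_le0 x y : mdist x y <= 0 -> x = y.
Proof.
by move=> h; apply: mdist_positivity; apply/eqP; rewrite eq_le h mdist_ge0.
Qed.

Lemma mdist_sqr_le0 x y : mdist x y ^+ 2 <= 0 -> x = y.
Proof.
move=> h; apply: mdist_positivity; apply/eqP.
by rewrite -sqrf_eq0 eq_le h sqr_ge0.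
Qed.

Lemma geopt_unique x y t z : 0 <= t <= 1 ->
  mdist x z <= t * mdist x y -> mdist z y <= (1 - t) * mdist x y ->
  z = geopt x y t.
Proof.
move=> t01 h1 h2; have /andP[t0 t1] := t01; apply: mdist_sqr_le0.
have := stewart_le z x y t01; rewrite [mdist z x]metric_sym.
have e1 : mdist x z ^+ 2 <= (t * mdist x y) ^+ 2.
  by rewrite ler_pXn2r ?nnegrE ?mdist_ge0 ?mulr_ge0 ?mdist_ge0.
have e2 : mdist z y ^+ 2 <= ((1 - t) * mdist x y) ^+ 2.
  by rewrite ler_pXn2r ?nnegrE ?mdist_ge0 ?mulr_ge0 ?mdist_ge0 ?subr_ge0.
move=> /le_trans; apply.
have : (1 - t) * mdist x z ^+ 2 <= (1 - t) * (t * mdist x y) ^+ 2.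
  by rewrite ler_wpM2l// subr_ge0.
have : t * mdist z y ^+ 2 <= t * ((1 - t) * mdist x y) ^+ 2 by rewrite ler_wpM2l.
lra.
Qed.

Lemma onem01 t : 0 <= t <= 1 -> 0 <= 1 - t <= 1.
Proof. by move=> /andP[t0 t1]; rewrite subr_ge0 t1/= lerBlDr lerDl. Qed.

Lemma half01 : 0 <= (2^-1 : R) <= 1.
Proof. by rewrite invr_ge0 ler0n/= invf_le1 ?ltr0n// ler1n. Qed.

Lemma geopt_sym x y t : 0 <= t <= 1 -> geopt x y t = geopt y x (1 - t).
Proof.
move=> t01; apply: geopt_unique; first exact: onem01.
  by rewrite metric_sym mdist_geoptr// [mdist y x]metric_sym.
by rewrite metric_sym mdist_geoptl// [mdist y x]metric_sym subKr.
Qed.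

(** Stewart's inequality seen from [geopt x y' t], and then from [y]. *)
Lemma mdist_geopt_common x y y' t : 0 <= t <= 1 ->
  mdist (geopt x y t) (geopt x y' t) <= t * mdist y y'.
Proof.
move=> t01; have /andP[t0 t1] := t01.
rewrite -(ler_pXn2r (_ : 0 < 2)%N) ?nnegrE ?mdist_ge0 ?mulr_ge0 ?mdist_ge0//.
rewrite metric_sym.
have h1 := stewart_le (geopt x y' t) x y t01.
have h2 := stewart_le y x y' t01.
rewrite [mdist (geopt x y' t) x]metric_sym mdist_geoptl// in h1.
rewrite [mdist (geopt x y' t) y]metric_sym in h1.
rewrite [mdist y x]metric_sym in h2.
have := ler_wpM2l t0 h2.
move: h1; nra.
Qed.

Lemma mdist_geopt_le x y x' y' t : 0 <= t <= 1 ->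
  mdist (geopt x y t) (geopt x' y' t) <= (1 - t) * mdist x x' + t * mdist y y'.
Proof.
move=> t01; apply: le_trans (metric_triangle _ (geopt x y' t) _) _.
rewrite addrC lerD ?mdist_geopt_common//.
rewrite (geopt_sym _ _ t01) (geopt_sym x' _ t01).
by apply: mdist_geopt_common; exact: onem01.
Qed.

(** Compare both [y] and [w] with the midpoint of [x] and [z].  In the plane the
    two sides differ by four times the squared distance between the midpoints of
    the diagonals. *)
Lemma quadrilateral_le x y z w :
  mdist x z ^+ 2 + mdist y w ^+ 2 <=
  mdist x y ^+ 2 + mdist y z ^+ 2 + mdist z w ^+ 2 + mdist w x ^+ 2.
Proof.
set m := geopt x z 2^-1.
have h1 : mdist y m ^+ 2 <= _ := stewart_le y x z half01.
have h2 : mdist w m ^+ 2 <= _ := stewart_le w x z half01.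
have h3 : mdist y w ^+ 2 <= (mdist y m + mdist w m) ^+ 2.
  rewrite ler_pXn2r ?nnegrE ?addr_ge0 ?mdist_ge0//.
  by rewrite [mdist w m]metric_sym metric_triangle.
have h4 : (mdist y m + mdist w m) ^+ 2 <= 2 * (mdist y m ^+ 2 + mdist w m ^+ 2).
  by have := sqr_ge0 (mdist y m - mdist w m); nra.
rewrite [mdist y x]metric_sym in h1; rewrite [mdist w z]metric_sym in h2.
lra.
Qed.

(** Convexity phrased with the chosen geodesics, which suffices since geodesics
    are unique. *)
Definition geoconvex (C : set X) :=
  forall x y t, C x -> C y -> 0 <= t <= 1 -> C (geopt x y t).

Lemma geoconvexP (C : set X) : geodesically_convex C <-> geoconvex C.
Proof.
split=> [Cc x y t Cx Cy t01|Cc x y S Cx Cy [c [c0 c1 ci ->]]].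
  by have [S [gS St]] := geopt_segment x y; exact: (Cc _ _ _ Cx Cy gS _ (St t t01)).
move=> _ [s sI <-]; move: sI; rewrite /= in_itv/= => /andP[s0 s1].
have [d0|dN0] := eqVneq (mdist x y) 0.
  have -> : s = 0 by apply/eqP; rewrite eq_le s0 -d0 s1.
  by rewrite c0.
have dgt0 : 0 < mdist x y by rewrite lt_def dN0 mdist_ge0.
have t01 : 0 <= s / mdist x y <= 1.
  by rewrite divr_ge0 ?mdist_ge0//= ler_pdivrMr// mul1r.
suff -> : c s = geopt x y (s / mdist x y) by apply: Cc.
apply: geopt_unique => //.
  rewrite divfK// -{1}c0 ci ?in_itv/= ?lexx ?s0 ?mdist_ge0//.
  by rewrite sub0r normrN ger0_norm.
rewrite mulrBl mul1r divfK// -{1}c1 ci ?in_itv/= ?lexx ?s0 ?mdist_ge0//.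
by rewrite distrC ger0_norm// subr_ge0.
Qed.

End Geodesics.

(** * Completeness and nearest-point projections *)

Lemma invn_small {R : realType} (e : R) :
  0 < e -> exists N : nat, forall n, (N <= n)%N -> n.+1%:R^-1 < e.
Proof.
move=> e0; exists (Num.bound e^-1) => n Nn.
have ei : 0 <= e^-1 by rewrite invr_ge0 ltW.
rewrite invf_plt ?posrE//; apply: lt_le_trans (archi_boundP ei) _.
by rewrite ler_nat leqW.
Qed.

Section MetricSequences.
Context {R : realType} {X : metricType R}.
Implicit Types (u : nat -> X) (A : set X) (x y : X) (e : R).

Definition cauchy_seq u := forall e, 0 < e ->
  exists N, forall m n, (N <= m)%N -> (N <= n)%N -> mdist (u m) (u n) < e.

Definition converges_to u x := forall e, 0 < e ->
  exists N, forall n, (N <= n)%N -> mdist (u n) x < e.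

Definition sequentially_complete := forall u, cauchy_seq u ->
  exists x, converges_to u x.

Lemma closed_mdistP A :
  closed A <-> forall x, (forall e, 0 < e -> exists2 y, A y & mdist x y < e) -> A x.
Proof.
split=> [Acl x xA|Acl x xA].
  apply: Acl => B /nbhs_ballP[e /= e0 eB].
  have [y Ay xy] := xA _ e0; exists y; split=> //; apply: eB.
  by rewrite ballEmdist.
apply: Acl => e e0; have [y []] := xA _ (nbhsx_ballx x _ e0).
by rewrite ballEmdist => Ay xy; exists y.
Qed.

Lemma closed_converges A u x :
  closed A -> (forall n, A (u n)) -> converges_to u x -> A x.
Proof.
move=> /closed_mdistP Acl uA ux; apply: Acl => e e0.
have [N xN] := ux _ e0; exists (u N) => //.
by rewrite metric_sym xN.
Qed.

Lemma mdist_converges_le u x z (r : R) :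
  converges_to u x -> (forall e, 0 < e ->
    exists N, forall n, (N <= n)%N -> mdist z (u n) < r + e) -> mdist z x <= r.
Proof.
move=> ux uz; apply/ler_addgt0Pr => e e0.
have e2 : 0 < e / 2 by rewrite divr_gt0.
have [N1 h1] := ux _ e2; have [N2 h2] := uz _ e2.
apply: le_trans (metric_triangle _ (u (maxn N1 N2)) _) _.
have := h1 _ (leq_maxl N1 N2); have := h2 _ (leq_maxr N1 N2); lra.
Qed.

Lemma eq_mdist_small x y : (forall e, 0 < e -> mdist x y <= e) -> x = y.
Proof.
by move=> h; apply: mdist_le0; apply/ler_addgt0Pr => e e0; rewrite add0r h.
Qed.

Lemma compact_cluster_seq A u : compact A -> (forall n, A (u n)) ->
  exists2 x, A x & forall e N, 0 < e -> exists2 n, (N <= n)%N & mdist (u n) x < e.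
Proof.
move=> Ac uA.
have [|x [Ax clx]] := Ac (u @ \oo) _; first by exists 0%N => // n _; exact: uA.
exists x => // e N e0.
have [|_ [[n /= Nn <-] h]] := clx (u @` [set n | (N <= n)%N]) _ _ (nbhsx_ballx x _ e0).
  by exists N => // n /= Nn; exists n.
by exists n => //; rewrite metric_sym; move: h; rewrite ballEmdist.
Qed.

End MetricSequences.
Arguments sequentially_complete {R} X.

Section Projection.
Context {R : realType} {X : metricType R}.
Hypotheses (catX : CAT0 X) (complX : sequentially_complete X).
Implicit Types (C : set X) (x y z : X).
Local Notation geopt := (geopt catX).

Definition closed_convex C := closed C /\ geoconvex catX C.

Definition proj C x : X :=
  xget x [set y | C y /\ forall z, C z -> mdist x y <= mdist x z].

(** A minimizing sequence is Cauchy, because the midpoint of two almost nearest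
    points is no closer. *)
Lemma nearest_ex C x : C !=set0 -> closed_convex C ->
  exists y, C y /\ forall z, C z -> mdist x y <= mdist x z.
Proof.
move=> [c0 Cc0] [Ccl Ccv]; pose D := mdist x @` C.
have Dinf : has_inf D.
  split; first by exists (mdist x c0), c0.
  by exists 0 => _ [z _ <-]; exact: mdist_ge0.
have D0 : 0 <= inf D.
  by apply: lb_le_inf Dinf.1 _ => _ [z _ <-]; exact: mdist_ge0.
have Dle z : C z -> inf D <= mdist x z.
  by move=> Cz; apply: (ge_inf Dinf.2); exists z.
have uex n : exists z, C z /\ mdist x z < inf D + n.+1%:R^-1.
  have [|_ [z Cz <-] zlt] := @inf_adherent _ D n.+1%:R^-1 _ Dinf; last by exists z.
  by rewrite invr_gt0.
have [u uP] := choice uex.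
have inv1 n : (n.+1%:R^-1 : R) <= 1 by rewrite invf_le1 ?ltr0n// ler1n.
have inv0 n : 0 <= (n.+1%:R^-1 : R) by rewrite invr_ge0.
have usq n : mdist x (u n) ^+ 2 <= inf D ^+ 2 + (2 * inf D + 1) * n.+1%:R^-1.
  have i0 := inv0 n; have i1 := inv1 n.
  apply: (@le_trans _ _ ((inf D + n.+1%:R^-1) ^+ 2)).
    by rewrite ler_pXn2r ?nnegrE ?mdist_ge0 ?addr_ge0// ltW// (uP n).2.
  have : 0 <= n.+1%:R^-1 * (1 - n.+1%:R^-1 : R) by rewrite mulr_ge0 ?subr_ge0.
  by move: (n.+1%:R^-1) => i; nra.
have ucauchy : cauchy_seq u.
  move=> e e0; pose k : R := 4 * (2 * inf D + 1).
  have k0 : 0 < k by rewrite /k; lra.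
  have [N hN] : exists N : nat, forall n, (N <= n)%N -> n.+1%:R^-1 < e ^+ 2 / k.
    by apply: invn_small; rewrite divr_gt0// exprn_gt0.
  exists N => m n Nm Nn.
  rewrite -(ltr_pXn2r (_ : 0 < 2)%N) ?nnegrE ?mdist_ge0 ?ltW//.
  have hm := hN _ Nm; have hn := hN _ Nn.
  rewrite ltr_pdivlMr// in hm; rewrite ltr_pdivlMr// in hn.
  have h := stewart_le catX x (u m) (u n) half01.
  have mid : inf D ^+ 2 <= mdist x (geopt (u m) (u n) 2^-1) ^+ 2.
    rewrite ler_pXn2r ?nnegrE ?mdist_ge0//; apply: Dle.
    by apply: Ccv (uP m).1 (uP n).1 half01.
  have := usq m; have := usq n; rewrite /k in hm hn *.
  by move: (m.+1%:R^-1) (n.+1%:R^-1) hm hn => i j; lra.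
have [y uy] := complX ucauchy; exists y.
have Cy : C y by apply: closed_converges uy => // n; exact: (uP n).1.
split=> // z Cz; apply: le_trans (Dle _ Cz).
apply: mdist_converges_le uy _ => e e0; have [N hN] := invn_small e0.
by exists N => n Nn; apply: lt_trans (uP n).2 _; rewrite ltrD2l hN.
Qed.

Section FixedSet.
Context {C : set X}.
Hypotheses (C0 : C !=set0) (Ccc : closed_convex C).
Local Notation p := (proj C).

Lemma projP x : C (p x) /\ forall z, C z -> mdist x (p x) <= mdist x z.
Proof. exact: (xgetPex x (nearest_ex x C0 Ccc)). Qed.

Lemma proj_in x : C (p x). Proof. exact: (projP x).1. Qed.

Lemma proj_min x z : C z -> mdist x (p x) <= mdist x z.
Proof. exact: (projP x).2. Qed.

(** The angle at the projection is at least a right angle: compare with points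
    of the segment from [p x] to [z] close to [p x]. *)
Lemma proj_obtuse x z : C z ->
  mdist x (p x) ^+ 2 + mdist (p x) z ^+ 2 <= mdist x z ^+ 2.
Proof.
move=> Cz; set A := mdist x _ ^+ 2; set B := mdist x z ^+ 2.
set L := mdist (p x) z ^+ 2; rewrite leNgt; apply/negP => BAL.
have AB : A <= B by rewrite /A /B ler_pXn2r ?nnegrE ?mdist_ge0// proj_min.
have L0 : 0 < L by lra.
pose t := (A + L - B) / (2 * L).
have tL : t * L = (A + L - B) / 2 by rewrite /t; field; rewrite gt_eqF.
have t0 : 0 < t by rewrite -(pmulr_lgt0 _ L0) tL; lra.
have t1 : t <= 1 by rewrite -(ler_pM2r L0) tL; lra.
have t01 : 0 <= t <= 1 by rewrite ltW.
have : A <= (1 - t) * A + t * B - t * (1 - t) * L.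
  apply: le_trans (stewart_le catX x (p x) z t01).
  rewrite ler_pXn2r ?nnegrE ?mdist_ge0//; apply: proj_min.
  by apply: Ccc.2 => //; exact: proj_in.
have -> : (1 - t) * A + t * B - t * (1 - t) * L =
          A + t * (B - A - L + t * L) by ring.
rewrite tL lerDl pmulr_rge0//; lra.
Qed.

Lemma proj_unique x z : C z -> mdist x z <= mdist x (p x) -> p x = z.
Proof.
move=> Cz xz; apply: mdist_sqr_le0; have := proj_obtuse x Cz.
have : mdist x z ^+ 2 <= mdist x (p x) ^+ 2.
  by rewrite ler_pXn2r ?nnegrE ?mdist_ge0.
by lra.
Qed.

Lemma proj_id x : C x -> p x = x.
Proof. by move=> Cx; apply: proj_unique; rewrite ?mdistxx ?mdist_ge0. Qed.

(** Two right angles at [p x] and [p y] make the opposite side [x y] the longer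
    one. *)
Lemma proj_lip x y : mdist (p x) (p y) <= mdist x y.
Proof.
apply: mdist_le_sqr.
have h1 := proj_obtuse x (proj_in y); have h2 := proj_obtuse y (proj_in x).
have := quadrilateral_le catX x y (p y) (p x).
rewrite [mdist (p y) (p x)]metric_sym in h2 *.
rewrite [mdist (p x) x]metric_sym; lra.
Qed.

End FixedSet.
End Projection.

(** * Subspaces and compact sets *)

(** An alias of [set_type A], so that it can carry the restricted metric. *)
Definition metric_sub {R : realType} {X : metricType R} (A : set X) : Type :=
  set_type A.

Section MetricSub.
Context {R : realType} {X : metricType R} (A : set X).

HB.instance Definition _ := Choice.on (metric_sub A).

Let d (u v : metric_sub A) : R := mdist (sval u) (sval v).
Let dxx u : d u u = 0. Proof. exact: mdistxx. Qed.
Let d0 u v : d u v = 0 -> u = v.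
Proof. by move/mdist_positivity => uv; exact: val_inj. Qed.
Let dC u v : d u v = d v u. Proof. exact: metric_sym. Qed.
Let dtri v u w : d u w <= d u v + d v w. Proof. exact: metric_triangle. Qed.

HB.instance Definition _ := isMetric.Build R (metric_sub A) dxx d0 dC dtri.

Lemma mdist_subE (u v : metric_sub A) : mdist u v = mdist (sval u) (sval v).
Proof. by []. Qed.

Lemma metric_subP (u : metric_sub A) : A (sval u).
Proof. exact: set_valP. Qed.

End MetricSub.

(** Total in [x], so that the inverse of the splitting can be defined on the
    whole space. *)
Definition into_sub {R : realType} {X : metricType R} (A : set X)
    (a0 : metric_sub A) (x : X) : metric_sub A :=
  insubd (a0 : set_type A) x.

Lemma into_subK {R : realType} {X : metricType R} (A : set X) (a0 : metric_sub A)
  (x : X) : A x -> sval (into_sub a0 x) = x.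
Proof. by move=> Ax; apply: insubdK; rewrite inE. Qed.

Section CompactMetric.
Context {R : realType} {X Y : metricType R}.

Lemma compact_short_image (A : set X) (F : X -> Y) : compact A ->
  (forall x y, A x -> A y -> mdist (F x) (F y) <= mdist x y) -> compact (F @` A).
Proof.
move=> Ac Flip; apply: continuous_compact => //.
apply/subspace_continuousP => x Ax; apply/cvg_ballP => e e0.
rewrite near_withinE; near=> y => Ay; rewrite ballEmdist /=.
apply: le_lt_trans (Flip _ _ Ax Ay) _.
by near: y; apply/nbhs_ballP; exists e => //= y; rewrite ballEmdist.
Unshelve. all: by end_near. Qed.

Lemma compact_bounded (A : set X) (x : X) : compact A ->
  exists N : R, forall y, A y -> mdist y x <= N.
Proof.
move=> Ac; apply: contrapT => noN.
have ex n : exists y, A y /\ n%:R < mdist y x.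
  apply: contrapT => noy; apply: noN; exists n%:R => y Ay.
  by rewrite leNgt; apply/negP => ny; apply: noy; exists y.
have [u uP] := choice ex.
have [a Aa cla] := compact_cluster_seq Ac (fun n => (uP n).1).
have a0 : 0 <= mdist a x + 1 by rewrite addr_ge0 ?mdist_ge0.
have [n nb na] := cla 1 (Num.bound (mdist a x + 1)) ltr01.
have := (uP n).2; have := metric_triangle (u n) a x.
have := archi_boundP a0.
have : (Num.bound (mdist a x + 1))%:R <= n%:R :> R by rewrite ler_nat.
lra.
Qed.

End CompactMetric.

Lemma finite_bigcup_compact {T : topologicalType} {I : choiceType} (D : set I)
    (K : I -> set T) : finite_set D -> (forall i, D i -> compact (K i)) ->
  compact (\bigcup_(i in D) K i).
Proof.
move=> /finite_seqP[s ->] Kc; rewrite bigcup_seq big_seq.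
by apply: bigsetU_compact => i si; exact: Kc.
Qed.

(** * Proper cocompact actions *)

Section GeometricAction.
Context {R : realType} {X : metricType R} {G : groupType}.
Variable act : G -> X -> X.
Hypothesis geom : geometric_action_on act [set: X].
Implicit Types (g h : G) (x y z w : X) (K : set X).

Let act1 x : act 1%g x = x. Proof. exact: geometric_act1 geom _ I. Qed.
Let actM g h x : act (g * h)%g x = act g (act h x).
Proof. exact: geometric_actM geom _ _ _ I. Qed.
Let act_iso g x y : mdist (act g x) (act g y) = mdist x y.
Proof. exact: geometric_isometric geom _ _ _ I I. Qed.

(** Two elements moving [z] close to [w] differ by an element moving [z] little. *)
Lemma proper_point z w :
  exists2 e : R, 0 < e & finite_set [set g | mdist (act g z) w < e].
Proof.
have [r r0 fin] := geometric_proper geom (x := z) I.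
exists (r / 2); first by rewrite divr_gt0.
have [[g0 /= g0w]|no] := pselect (exists g, mdist (act g z) w < r / 2); last first.
  by apply: sub_finite_set (@finite_set0 G) => g /= gw; case: no; exists g.
apply: sub_finite_set (finite_image (fun g => (g0 * g)%g) fin) => g /= gw.
exists (g0^-1 * g)%g; last by rewrite mulgA mulgV mul1g.
exists (act (g0^-1 * g)%g z); split; [exists z => //|]; split=> //.
  by rewrite ballEmdist /= mdistxx.
rewrite ballEmdist /= -(act_iso g0) -actM mulgA mulgV mul1g.
have := metric_triangle (act g0 z) w (act g z).
by rewrite [mdist w _]metric_sym; lra.
Qed.

(** Uniform version of the previous lemma.  The covering argument runs over pairs
    of a radius and a finite set of group elements, ordered by shrinking the
    first and growing the second. *)
Lemma proper_compact K z : compact K ->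
  exists2 e : R, 0 < e &
    finite_set [set g | exists2 k, K k & mdist (act g z) k < e].
Proof.
move=> /compact_near_coveringP Kc.
pose D := [set s : R * set G | 0 < s.1 /\ finite_set s.2].
pose B (s : R * set G) :=
  [set s' : R * set G | [/\ 0 < s'.1, s'.1 <= s.1, finite_set s'.2 & s.2 `<=` s'.2]].
have Ff : Filter (filter_from D B).
  apply: filter_from_filter; first by exists (1, set0); split=> //; exact: ltr01.
  move=> [e A] [e' A'] [/= e0 Af] [/= e0' Af'].
  exists (Num.min e e', A `|` A').
    by split; rewrite /= ?lt_min ?e0//; rewrite finite_setU.
  move=> [e'' A''] [/= ? + ? AA]; rewrite le_min => /andP[? ?].
  by split; split=> //= x ?; apply: AA; [left|right].
have [|[e A] [/= e0 Af] h] :=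
  Kc _ _ (fun s x => [set g | mdist (act g z) x < s.1] `<=` s.2) Ff.
  move=> x Kx; have [e e0 fin] := proper_point z x.
  have e2 : 0 < e / 2 by rewrite divr_gt0.
  exists (ball x (e / 2), B (e / 2, [set g | mdist (act g z) x < e])).
    split; first exact: nbhsx_ballx.
    by exists (e / 2, [set g | mdist (act g z) x < e]).
  move=> [y [e' A']] /= [xy [/= ? e'e ? AA]] g /= gy; apply: AA => /=.
  move: xy; rewrite ballEmdist /=.
  by have := metric_triangle (act g z) y x; rewrite [mdist x y]metric_sym; lra.
exists e => //; apply: (sub_finite_set _ Af) => g [k Kk gk].
have BA : B (e, A) (e, A) by split; rewrite /= ?lexx.
exact: (h _ BA _ Kk _ gk).
Qed.

(** Write the terms of a Cauchy sequence as [g_n k_n] with [k_n] in a compact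
    fundamental domain [K].  When [k_n] is close to a cluster point [k0], the
    points [g_n k0] are close to each other, so by properness the [g_n] range
    over finitely many elements and infinitely many terms of the sequence lie in
    a finite union of translates of [K]. *)
Lemma geometric_complete : sequentially_complete X.
Proof.
move=> u ucauchy; have [K [Kc _ KX]] := geometric_cocompact geom.
have ex n : exists s : G * X, K s.2 /\ act s.1 s.2 = u n.
  by have : [set: X] (u n) by []; rewrite -KX => -[g _ [k Kk gk]]; exists (g, k).
have {ex}[s sP] := choice ex; pose k n := (s n).2; pose g n := (s n).1.
have Kk n : K (k n) := (sP n).1; have gk n : act (g n) (k n) = u n := (sP n).2.
have [k0 Kk0 clk] := compact_cluster_seq Kc Kk.
have [e e0 fin] := proper_point k0 k0.
have e4 : 0 < e / 4 by rewrite divr_gt0.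
have [N hN] := ucauchy _ e4; have [m Nm km] := clk _ N e4.
pose A := \bigcup_(h in [set h | mdist (act h k0) k0 < e]) (act (g m * h)%g @` K).
have Ac : compact A.
  apply: finite_bigcup_compact => // h _; apply: compact_short_image => // x y _ _.
  by rewrite act_iso.
have exA n : exists i, (n <= i)%N /\ A (u i).
  have [i ni ki] := clk _ (maxn n N) e4.
  have Ni : (N <= i)%N by apply: leq_trans ni; exact: leq_maxr.
  exists i; split; first by apply: leq_trans ni; exact: leq_maxl.
  exists ((g m)^-1 * g i)%g => /=; last first.
    by exists (k i) => //; rewrite mulgA mulgV mul1g gk.
  rewrite -(act_iso (g m)) -actM mulgA mulgV mul1g.
  have := metric_triangle (act (g i) k0) (u i) (act (g m) k0).
  have := metric_triangle (u i) (u m) (act (g m) k0).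
  have := hN _ _ Ni Nm.
  have : mdist (act (g i) k0) (u i) < e / 4 by rewrite -gk act_iso metric_sym.
  have : mdist (u m) (act (g m) k0) < e / 4 by rewrite -gk act_iso.
  lra.
have [v vP] := choice exA.
have [l Al cll] := compact_cluster_seq Ac (fun n => (vP n).2).
exists l => r r0; have r2 : 0 < r / 2 by rewrite divr_gt0.
have [N' hN'] := ucauchy _ r2; exists N' => n Nn.
have [i Ni vi] := cll _ N' r2.
have := hN' _ _ Nn (leq_trans Ni (vP i).1).
have := metric_triangle (u n) (u (v i)) l; lra.
Qed.

End GeometricAction.

(** * Minimal invariant closed convex sets *)

Definition isometric_on {R : realType} {X Y : metricType R} (A : set X)
    (F : X -> Y) :=
  forall x y, A x -> A y -> mdist (F x) (F y) = mdist x y.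

Section Minimal.
Context {R : realType} {X : metricType R} {H : groupType}.
Hypotheses (catX : CAT0 X) (complX : sequentially_complete X).
Variable act : H -> X -> X.
Hypotheses (act1 : forall x, act 1%g x = x)
           (actM : forall g h x, act (g * h)%g x = act g (act h x))
           (act_iso : forall g x y, mdist (act g x) (act g y) = mdist x y).
Implicit Types (A C M N : set X) (F : X -> X) (x y z : X) (g h : H).
Local Notation geopt := (geopt catX).
Local Notation closed_convex := (closed_convex catX).

Lemma isometric_geopt C F x y t : geoconvex catX C -> isometric_on C F ->
  C x -> C y -> 0 <= t <= 1 -> F (geopt x y t) = geopt (F x) (F y) t.
Proof.
move=> Ccv Fi Cx Cy t01; have Cz := Ccv _ _ _ Cx Cy t01.
by apply: geopt_unique => //; rewrite !Fi// ?mdist_geoptl ?mdist_geoptr.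
Qed.

Lemma act_geopt g x y t : 0 <= t <= 1 ->
  act g (geopt x y t) = geopt (act g x) (act g y) t.
Proof. by apply: (@isometric_geopt setT) => // x' y' _ _; exact: act_iso. Qed.

Lemma actK g x : act g^-1%g (act g x) = x.
Proof. by rewrite -actM mulVg act1. Qed.

Definition equivariant_on A F := forall g x, A x -> F (act g x) = act g (F x).

Definition minimal_set M :=
  [/\ M !=set0, closed_convex M, invariant_set act M &
    forall N, N !=set0 -> closed_convex N -> invariant_set act N ->
      N `<=` M -> M `<=` N].

Lemma closed_convexI A C : closed_convex A -> closed_convex C ->
  closed_convex (A `&` C).
Proof.
move=> [Acl Acv] [Ccl Ccv]; split; first exact: closedI.
by move=> x y t [Ax Cx] [Ay Cy] t01; split; [exact: Acv|exact: Ccv].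
Qed.

Lemma invariant_setI A C : invariant_set act A -> invariant_set act C ->
  invariant_set act (A `&` C).
Proof. by move=> Ai Ci g x [Ax Cx]; split; [exact: Ai|exact: Ci]. Qed.

(** The sublevel sets of [h] are competitors in the definition of minimality. *)
Lemma minimal_constant M (h : X -> R) : minimal_set M ->
  (forall x y, M x -> M y -> h x <= h y + 2 * mdist x y) ->
  (forall x y t r, M x -> M y -> 0 <= t <= 1 -> h x <= r -> h y <= r ->
    h (geopt x y t) <= r) ->
  (forall g x, M x -> h (act g x) = h x) ->
  forall x y, M x -> M y -> h x = h y.
Proof.
move=> [_ [Mcl Mcv] Mi Mmin] hlip hcv hi.
suff hle x y : M x -> M y -> h y <= h x.
  by move=> x y Mx My; apply/eqP; rewrite eq_le !hle.
move=> Mx My; pose N := M `&` [set z | h z <= h x].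
suff : M `<=` N by move=> /(_ _ My)[].
apply: Mmin => [||g z [Mz /= hz]|]; last by move=> z [].
- by exists x; split => /=.
- split=> [|z w t [Mz /= hz] [Mw /= hw] t01]; last first.
    by split; [exact: Mcv|exact: hcv].
  apply/closed_mdistP => z zN.
  have Mz : M z.
    move/closed_mdistP: Mcl; apply => e e0.
    by have [w [Mw _] zw] := zN _ e0; exists w.
  split=> //=; apply/ler_addgt0Pr => e e0.
  have e2 : 0 < e / 2 by rewrite divr_gt0.
  have [w [Mw /= hw] zw] := zN _ e2.
  by have := hlip _ _ Mz Mw; lra.
- by split; [exact: Mi|rewrite /= hi].
Qed.

(** Completeness makes the image closed; uniqueness of geodesics makes it
    convex; minimality transfers through preimages. *)
Lemma minimal_image M F : minimal_set M -> isometric_on M F ->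
  equivariant_on M F -> minimal_set (F @` M).
Proof.
move=> [[m0 Mm0] [Mcl Mcv] Mi Mmin] Fi Fe; split.
- by exists (F m0), m0.
- split; last first.
    move=> _ _ t [x Mx <-] [y My <-] t01; exists (geopt x y t); first exact: Mcv.
    exact: isometric_geopt Mcv Fi Mx My t01.
  apply/closed_mdistP => y yFM.
  have uex n : exists z, M z /\ mdist y (F z) < n.+1%:R^-1.
    have [|_ [z Mz <-] yz] := yFM n.+1%:R^-1; first by rewrite invr_gt0.
    by exists z.
  have [u uP] := choice uex.
  have uM n : M (u n) := (uP n).1.
  have [|x ux] := complX (u := u).
    move=> e e0; have e2 : 0 < e / 2 by rewrite divr_gt0.
    have [N hN] := invn_small e2; exists N => m n Nm Nn.
    rewrite -Fi//; apply: le_lt_trans (metric_triangle _ y _) _.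
    rewrite [X in X + _]metric_sym.
    have := lt_trans (uP m).2 (hN _ Nm); have := lt_trans (uP n).2 (hN _ Nn); lra.
  have Mx : M x by apply: closed_converges ux.
  exists x => //; apply: eq_mdist_small => e e0.
  have e2 : 0 < e / 2 by rewrite divr_gt0.
  have [N1 h1] := ux _ e2; have [N2 h2] := invn_small e2.
  pose n := maxn N1 N2; apply: le_trans (metric_triangle _ (F (u n)) _) _.
  rewrite Fi// [mdist x _]metric_sym [mdist _ y]metric_sym.
  have := h1 _ (leq_maxl N1 N2).
  have := lt_trans (uP n).2 (h2 _ (leq_maxr N1 N2)); rewrite -/n; lra.
- by move=> g _ [x Mx <-]; exists (act g x); [exact: Mi|exact: Fe].
- move=> N [n0 Nn0] [Ncl Ncv] Ni NFM _ [x Mx <-].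
  suff : M `<=` M `&` F @^-1` N by move=> /(_ _ Mx)[].
  apply: Mmin => [||g z [Mz /= Nz]|]; last by move=> z [].
  + by have [z Mz zn] := NFM _ Nn0; exists z; split=> //=; rewrite zn.
  + split=> [|z w t [Mz /= Nz] [Mw /= Nw] t01]; last first.
      split; first exact: Mcv.
      by rewrite /= (isometric_geopt Mcv Fi)//; exact: Ncv.
    apply/closed_mdistP => z zM.
    have Mz : M z.
      move/closed_mdistP: Mcl; apply => e e0.
      by have [w [Mw _] zw] := zM _ e0; exists w.
    split=> //=; move/closed_mdistP: Ncl; apply => e e0.
    by have [w [Mw /= Nw] zw] := zM _ e0; exists (F w) => //; rewrite Fi.
  + by split; [exact: Mi|rewrite /= Fe//; exact: Ni].
Qed.

Lemma proj_equivariant C g x : C !=set0 -> closed_convex C ->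
  invariant_set act C -> proj C (act g x) = act g (proj C x).
Proof.
move=> C0 Ccc Ci; have pin := proj_in complX C0 Ccc.
apply: (proj_unique complX) => //; first exact/Ci/pin.
rewrite act_iso -[leRHS](act_iso g^-1%g) actK.
by apply: (proj_min complX) => //; exact/Ci/pin.
Qed.

Section TwoMinimal.
Variables (M N : set X).
Hypotheses (Mm : minimal_set M) (Nm : minimal_set N).

Let N0 : N !=set0. Proof. by case: Nm. Qed.
Let Ncc : closed_convex N. Proof. by case: Nm. Qed.
Let Ni : invariant_set act N. Proof. by case: Nm. Qed.

Lemma minimal_proj_in x : N (proj N x).
Proof. exact: (proj_in complX). Qed.

(** The distance to a convex invariant set is a convex invariant function. *)
Lemma gap_constant x y :
  M x -> M y -> mdist x (proj N x) = mdist y (proj N y).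
Proof.
apply: (minimal_constant (h := fun x => mdist x (proj N x))) => //.
- move=> z w _ _; have := proj_lip complX N0 Ncc w z.
  have := metric_triangle z w (proj N z).
  have := metric_triangle w (proj N w) (proj N z).
  by rewrite [mdist w z]metric_sym; lra.
- move=> z w t r _ _ t01 hz hw; have /andP[t0 t1] := t01.
  apply: le_trans (proj_min complX N0 Ncc _ _) _.
    exact: Ncc.2 (minimal_proj_in z) (minimal_proj_in w) t01.
  apply: le_trans (mdist_geopt_le _ _ _ _ _ t01) _.
  have : (1 - t) * mdist z (proj N z) <= (1 - t) * r by rewrite ler_wpM2l ?subr_ge0.
  have : t * mdist w (proj N w) <= t * r by rewrite ler_wpM2l.
  lra.
- by move=> g z _; rewrite proj_equivariant// act_iso.
Qed.

End TwoMinimal.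

Section Sandwich.
Variables (M N : set X).
Hypotheses (Mm : minimal_set M) (Nm : minimal_set N).

Let M0 : M !=set0. Proof. by case: Mm. Qed.
Let Mcc : closed_convex M. Proof. by case: Mm. Qed.
Let N0 : N !=set0. Proof. by case: Nm. Qed.
Let Ncc : closed_convex N. Proof. by case: Nm. Qed.

Lemma gap_sym x y : M x -> N y -> mdist x (proj N x) = mdist y (proj M y).
Proof.
move=> Mx Ny; apply/eqP; rewrite eq_le; apply/andP; split.
  rewrite (gap_constant Mm Nm Mx (minimal_proj_in Mm y)) [leRHS]metric_sym.
  exact: (proj_min complX).
rewrite (gap_constant Nm Mm Ny (minimal_proj_in Nm x)) [leRHS]metric_sym.
exact: (proj_min complX).
Qed.

(** [x] is at distance [mdist x (proj N x)] from [proj N x], and by [gap_sym] no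
    point of [M] is closer. *)
Lemma minimal_projK x : M x -> proj M (proj N x) = x.
Proof.
move=> Mx; apply: (proj_unique complX) => //.
by rewrite metric_sym (gap_sym Mx (minimal_proj_in Nm x)).
Qed.

Lemma minimal_proj_iso : isometric_on M (proj N).
Proof.
move=> x y Mx My; apply/eqP; rewrite eq_le (proj_lip complX)//=.
rewrite -{1}(minimal_projK Mx) -{1}(minimal_projK My).
exact: (proj_lip complX).
Qed.

(** The sandwich lemma: both diagonals of the quadrilateral [x], [y], [p y],
    [p x] are bounded below by the obtuse angles at the projections, and their
    sum of squares is bounded above by the sides. *)
Lemma minimal_pythagoras x y : M x -> M y ->
  mdist x (proj N y) ^+ 2 = mdist x (proj N x) ^+ 2 + mdist x y ^+ 2.
Proof.
move=> Mx My.
have h1 := proj_obtuse complX N0 Ncc x (minimal_proj_in Nm y).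
have h2 := proj_obtuse complX N0 Ncc y (minimal_proj_in Nm x).
have := quadrilateral_le catX x y (proj N y) (proj N x).
rewrite (gap_constant Mm Nm My Mx) in h2 *.
rewrite [mdist (proj N x) x]metric_sym.
rewrite [mdist (proj N y) (proj N x)]metric_sym in h2 *.
by rewrite !minimal_proj_iso// in h1 h2 *; lra.
Qed.

End Sandwich.

Lemma proj_minimal_equivariant N : minimal_set N ->
  forall g x, proj N (act g x) = act g (proj N x).
Proof. by case=> N0 Ncc Ni _ g x; exact: proj_equivariant. Qed.

(** * Absence of holonomy *)

Section Translation.
Variables (M : set X) (phi : X -> X) (delta : R).
Hypotheses (Mcv : geoconvex catX M) (phiM : forall x, M x -> M (phi x)).
Hypotheses (phi_iso : isometric_on M phi).
Hypothesis phi_disp : forall x, M x -> mdist x (phi x) = delta.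

(** The midpoint [m] of [x] and [phi x] is sent to the midpoint of [phi x] and
    [phi (phi x)], at distance [delta] from [m]. *)
Lemma translation_double x : M x -> mdist x (phi (phi x)) = 2 * delta.
Proof.
move=> Mx; have Mfx := phiM Mx; have Mffx := phiM Mfx.
apply/eqP; rewrite eq_le; apply/andP; split.
  have := metric_triangle x (phi x) (phi (phi x)).
  by rewrite !phi_disp//; lra.
have Mm := Mcv Mx Mfx half01.
have := phi_disp Mm; rewrite (isometric_geopt Mcv phi_iso Mx Mfx half01).
rewrite (geopt_sym catX x (phi x) half01).
have -> : 1 - 2^-1 = 2^-1 :> R by lra.
move=> <-; have := mdist_geopt_common catX (phi x) x (phi (phi x)) half01; lra.
Qed.

End Translation.

Lemma translation_iter_le M phi (delta : R) : (forall x, M x -> M (phi x)) ->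
  (forall x, M x -> mdist x (phi x) = delta) ->
  forall n x, M x -> M (iter n phi x) /\ mdist x (iter n phi x) <= n%:R * delta.
Proof.
move=> phiM disp; elim=> [|n IH] x Mx; first by rewrite mdistxx mul0r.
have [Mn dn] := IH x Mx; split; first exact: phiM.
apply: le_trans (metric_triangle _ (iter n phi x) _) _.
by rewrite /= disp// -natr1 mulrDl mul1r lerD.
Qed.

Lemma isometric_iter M phi n : (forall x, M x -> M (phi x)) ->
  isometric_on M phi -> isometric_on M (iter n phi).
Proof.
move=> phiM phi_iso; have itM k x : M x -> M (iter k phi x).
  by move=> Mx; elim: k => //= k; exact: phiM.
by elim: n => // n IH x y Mx My; rewrite /= phi_iso ?IH//; exact: itM.
Qed.

Lemma translation_pow2 M phi (delta : R) : geoconvex catX M ->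
  (forall x, M x -> M (phi x)) -> isometric_on M phi ->
  (forall x, M x -> mdist x (phi x) = delta) ->
  forall k x, M x -> mdist x (iter (2 ^ k) phi x) = (2 ^ k)%:R * delta.
Proof.
move=> Mcv phiM phi_iso disp; elim=> [|k IH] x Mx; first by rewrite mul1r disp.
have itM z : M z -> M (iter (2 ^ k) phi z).
  by move=> Mz; have [] := translation_iter_le phiM disp (2 ^ k) Mz.
have := translation_double Mcv itM (isometric_iter _ phiM phi_iso) IH Mx.
rewrite -iterD addnn -mul2n -expnS => ->.
by rewrite mulrA -natrM -expnS.
Qed.

(** The displacement of [phi ^ (2 ^ k)] leaves no room for the intermediate
    powers to move points by less. *)
Lemma translation_iter M phi (delta : R) : geoconvex catX M ->
  (forall x, M x -> M (phi x)) -> isometric_on M phi ->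
  (forall x, M x -> mdist x (phi x) = delta) ->
  forall n x, M x -> mdist x (iter n phi x) = n%:R * delta.
Proof.
move=> Mcv phiM phi_iso disp n x Mx.
have [Mn dn] := translation_iter_le phiM disp n Mx.
apply/eqP; rewrite eq_le dn/=.
have n2 : (n <= 2 ^ n)%N by rewrite ltnW// ltn_expl.
have [_ dm] := translation_iter_le phiM disp (2 ^ n - n) Mn.
rewrite -iterD subnK// in dm.
have := translation_pow2 Mcv phiM phi_iso disp n Mx => d2.
have := metric_triangle x (iter n phi x) (iter (2 ^ n) phi x).
rewrite d2; move: dm; rewrite natrB// mulrBl; lra.
Qed.

Section Holonomy.
Variables (M1 M2 M3 : set X).
Hypotheses (m1 : minimal_set M1) (m2 : minimal_set M2) (m3 : minimal_set M3).

Let phi x := proj M1 (proj M3 (proj M2 x)).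

Let phiM x : M1 x -> M1 (phi x).
Proof. by move=> _; exact: minimal_proj_in. Qed.

Let phi_iso : isometric_on M1 phi.
Proof.
have in2 := minimal_proj_in m2; have in3 := minimal_proj_in m3.
by move=> x y Mx My; rewrite /phi (minimal_proj_iso m3 m1)// (minimal_proj_iso m2 m3)//
  (minimal_proj_iso m1 m2).
Qed.

Let phi_equivariant g x : phi (act g x) = act g (phi x).
Proof. by rewrite /phi !proj_minimal_equivariant. Qed.

Let phi_disp x y : M1 x -> M1 y -> mdist x (phi x) = mdist y (phi y).
Proof.
have [_ [_ M1cv] _ _] := m1.
apply: (minimal_constant (h := fun x => mdist x (phi x))) => //.
- move=> z w Mz Mw; have := metric_triangle z w (phi z).
  have := metric_triangle w (phi w) (phi z).
  by rewrite (phi_iso Mw Mz) [mdist w z]metric_sym; lra.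
- move=> z w t r Mz Mw t01 hz hw; have /andP[t0 t1] := t01.
  rewrite (isometric_geopt M1cv phi_iso)//.
  apply: le_trans (mdist_geopt_le _ _ _ _ _ t01) _.
  have : (1 - t) * mdist z (phi z) <= (1 - t) * r by rewrite ler_wpM2l ?subr_ge0.
  have : t * mdist w (phi w) <= t * r by rewrite ler_wpM2l.
  lra.
- by move=> g z Mz; rewrite phi_equivariant act_iso.
Qed.

(** The composition [phi] of the three projections is a Clifford translation of
    [M1], of displacement [delta] say.  Going around the triangle of minimal
    sets while moving [n] steps of size [delta] along an axis on each side costs
    [3 n delta + O(1 / n)] by the Pythagorean identity, but joins [x] to
    [phi^(3 n + 1) x], at distance [(3 n + 1) delta]; hence [delta = 0]. *)
Lemma no_holonomy x : M1 x -> proj M1 (proj M3 (proj M2 x)) = x.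
Proof.
move=> Mx; have [_ [_ M1cv] _ _] := m1; rewrite -/(phi x).
apply/esym/mdist_le0; rewrite leNgt; apply/negP => d0.
set d := mdist x (phi x) in d0.
have disp z : M1 z -> mdist z (phi z) = d by move=> Mz; exact: phi_disp.
have itM n z : M1 z -> M1 (iter n phi z).
  by move=> Mz; have [] := translation_iter_le phiM disp n Mz.
have itd n z : M1 z -> mdist z (iter n phi z) = n%:R * d.
  exact: translation_iter M1cv phiM phi_iso disp _ _.
have in2 := minimal_proj_in m2; have in3 := minimal_proj_in m3.
set p := proj M2; set q := fun z => proj M3 (p z).
set A := mdist x (p x) ^+ 2 + mdist (p x) (q x) ^+ 2 + mdist (q x) (phi x) ^+ 2.
have nA n : (0 < n)%N -> 2 * n%:R * d ^+ 2 <= A.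
  move=> n0; pose u k := iter (k * n) phi x.
  have uM k : M1 (u k) by exact: itM.
  have du k : mdist (u k) (u k.+1) = n%:R * d by rewrite {2}/u mulSn iterD itd.
  pose s1 := mdist (u 0%N) (p (u 1%N)).
  pose s2 := mdist (p (u 1%N)) (q (u 2%N)).
  pose s3 := mdist (q (u 2%N)) (phi (u 3%N)).
  have e1 : s1 ^+ 2 = mdist x (p x) ^+ 2 + (n%:R * d) ^+ 2.
    by rewrite /s1 (minimal_pythagoras m1 m2)// du.
  have e2 : s2 ^+ 2 = mdist (p x) (q x) ^+ 2 + (n%:R * d) ^+ 2.
    rewrite /s2 (minimal_pythagoras m2 m3)// (minimal_proj_iso m1 m2)// du.
    by rewrite (gap_constant m2 m3 (in2 _) (in2 x)).
  have e3 : s3 ^+ 2 = mdist (q x) (phi x) ^+ 2 + (n%:R * d) ^+ 2.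
    have q3 z : M3 (q z) by exact: in3.
    have dq : mdist (q (u 2%N)) (q (u 3%N)) = n%:R * d.
      by rewrite /q (minimal_proj_iso m2 m3)// (minimal_proj_iso m1 m2)// du.
    rewrite /s3 (minimal_pythagoras m3 m1)// dq.
    by rewrite (gap_constant m3 m1 (in3 _) (in3 (p x))).
  have le3 : (3 * n).+1%:R * d <= s1 + s2 + s3.
    rewrite -(itd _ x Mx) iterS.
    apply: le_trans (metric_triangle _ (q (u 2%N)) _) _.
    by rewrite lerD2r metric_triangle.
  have nd0 : 0 < n%:R * d by rewrite mulr_gt0// ltr0n.
  have amgm s (b : R) : s ^+ 2 = b + (n%:R * d) ^+ 2 ->
      2 * (n%:R * d) * s <= b + 2 * (n%:R * d) ^+ 2.
    by move=> sE; have := sqr_ge0 (s - n%:R * d); lra.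
  have := amgm _ _ e1; have := amgm _ _ e2; have := amgm _ _ e3.
  have := ler_wpM2l (ltW nd0) le3; rewrite -natr1 natrM /A; lra.
have A0 : 0 <= A / d ^+ 2 by rewrite divr_ge0 ?sqr_ge0// !addr_ge0 ?sqr_ge0.
pose n := (Num.bound (A / d ^+ 2)).+1.
have dd : 0 < d ^+ 2 by rewrite exprn_gt0.
have := nA n isT; apply/negP; rewrite -ltNge.
have : A < n%:R * d ^+ 2.
  rewrite -ltr_pdivrMr//; apply: lt_trans (archi_boundP A0) _.
  by rewrite ltr_nat /n.
have : 0 <= n%:R * d ^+ 2 by rewrite mulr_ge0 ?ltW.
lra.
Qed.

Lemma minimal_proj_comp x : M1 x -> proj M3 (proj M2 x) = proj M3 x.
Proof.
move=> Mx; rewrite -[in RHS](no_holonomy Mx).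
by rewrite (minimal_projK m3 m1)//; exact: minimal_proj_in.
Qed.

End Holonomy.

(** * The union of the minimal sets *)

Section Slide.
Variables (M N : set X) (t : R).
Hypotheses (Mm : minimal_set M) (Nm : minimal_set N) (t01 : 0 <= t <= 1).

Let t0 : 0 <= t. Proof. by case/andP: t01. Qed.
Let t1 : 0 <= 1 - t. Proof. by case/andP: t01; rewrite subr_ge0. Qed.
Let M0 : M !=set0. Proof. by case: Mm. Qed.
Let Mcc : closed_convex M. Proof. by case: Mm. Qed.
Let Nin := minimal_proj_in Nm.

Definition slide x := geopt x (proj N x) t.

(** A point of [M] closer to [slide x] than [x] would be closer to [N] than the
    constant gap. *)
Lemma slide_projK x : M x -> proj M (slide x) = x.
Proof.
move=> Mx; have Min := minimal_proj_in Mm.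
apply: (proj_unique complX M0 Mcc) => //.
rewrite metric_sym mdist_geoptl//; set z := proj M (slide x).
have [N0 Ncc _ _] := Nm; have := proj_min complX N0 Ncc z (Nin x).
rewrite (gap_constant Mm Nm (Min _) Mx).
have := metric_triangle z (slide x) (proj N x).
by rewrite [mdist z (slide x)]metric_sym mdist_geoptr//; lra.
Qed.

(** Convexity of the metric gives one inequality; the other one holds because
    [proj M] is a 1-Lipschitz left inverse of [slide]. *)
Lemma slide_iso : isometric_on M slide.
Proof.
move=> x y Mx My; apply/eqP; rewrite eq_le; apply/andP; split; last first.
  by rewrite -{1}(slide_projK Mx) -{1}(slide_projK My) (proj_lip complX).
apply: le_trans (mdist_geopt_le _ _ _ _ _ t01) _.
by rewrite (minimal_proj_iso Mm Nm)//; lra.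
Qed.

Lemma slide_minimal : minimal_set (slide @` M).
Proof.
apply: minimal_image => //; first exact: slide_iso.
by move=> g x _; rewrite /slide proj_minimal_equivariant// act_geopt.
Qed.

(** Stewart's inequality and the Pythagorean identity bound the distances from
    [slide (geopt x y t)] to both ends of the diagonal by those of the dividing
    point, which is unique. *)
Lemma slide_diagonal x y : M x -> M y ->
  geopt x (proj N y) t = slide (geopt x y t).
Proof.
move=> Mx My; have Mw : M (geopt x y t) by exact: Mcc.2.
set w := geopt x y t in Mw *.
have dxw : mdist x w = t * mdist x y by rewrite mdist_geoptl.
have dwy : mdist w y = (1 - t) * mdist x y by rewrite mdist_geoptr.
have gap z : M z -> mdist z (proj N z) = mdist x (proj N x).
  by move=> Mz; exact: (gap_constant Mm Nm Mz Mx).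
have pyth z z' : M z -> M z' -> mdist z (proj N z') ^+ 2 =
    mdist x (proj N x) ^+ 2 + mdist z z' ^+ 2.
  by move=> Mz Mz'; rewrite (minimal_pythagoras Mm Nm)// gap.
have xy := pyth _ _ Mx My; have xw := pyth _ _ Mx Mw; have wy := pyth _ _ Mw My.
apply/esym; apply: geopt_unique => //.
  rewrite -(ler_pXn2r (_ : 0 < 2)%N) ?nnegrE ?mulr_ge0 ?mdist_ge0//.
  apply: le_trans (stewart_le _ _ _ _ t01) _.
  by rewrite gap// xw exprMn xy dxw exprMn; lra.
rewrite -(ler_pXn2r (_ : 0 < 2)%N) ?nnegrE ?mulr_ge0 ?mdist_ge0//.
rewrite metric_sym; apply: le_trans (stewart_le _ _ _ _ t01) _.
rewrite gap// [mdist (proj N y) w]metric_sym wy [mdist (proj N y) _]metric_sym.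
by rewrite (minimal_proj_iso Mm Nm)// exprMn xy dwy exprMn; lra.
Qed.

End Slide.

Definition minimal_union : set X := [set x | exists2 M, minimal_set M & M x].

(** The intermediate slices of the strip between two minimal sets are minimal. *)
Lemma minimal_union_convex : geoconvex catX minimal_union.
Proof.
move=> x y t [M Mm Mx] [N Nm Ny] t01.
have Mp : M (proj M y) by exact: minimal_proj_in.
rewrite -(minimal_projK Nm Mm Ny) (slide_diagonal Mm Nm t01 Mx Mp).
exists (slide N t @` M); first exact: slide_minimal.
exists (geopt x (proj M y) t) => //.
by case: Mm => _ [_ Mcv] _ _; exact: Mcv.
Qed.

(** By the absence of holonomy, [proj N z] and [proj N' z] realize the distance
    between [N] and [N']. *)
Lemma minimal_proj_gap M N N' y y' z : minimal_set M -> minimal_set N ->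
  minimal_set N' -> N y -> N' y' -> M z ->
  mdist (proj N z) (proj N' z) <= mdist y y'.
Proof.
move=> Mm Nm N'm Ny Ny' Mz.
rewrite -(minimal_proj_comp Mm Nm N'm Mz).
rewrite (gap_constant Nm N'm (minimal_proj_in Nm z) Ny).
by case: N'm => N0 Ncc _ _; exact: (proj_min complX).
Qed.

(** If [y] is the limit of points [y_n] of minimal sets [M_n], the projections
    of a fixed minimal set [C] onto the [M_n] converge uniformly to an
    equivariant isometric embedding of [C] whose image contains [y]. *)
Lemma minimal_union_closed : closed minimal_union.
Proof.
apply/closed_mdistP => y yZ.
have [z0 [C Cm _] _] := yZ 1 ltr01.
have ex n : exists s : set X * X,
    [/\ minimal_set s.1, s.1 s.2 & mdist y s.2 < n.+1%:R^-1].
  have [|z [M Mm Mz] yz] := yZ n.+1%:R^-1; first by rewrite invr_gt0.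
  by exists (M, z).
have {ex}[s sP] := choice ex; pose M n := (s n).1; pose v n := (s n).2.
have Mm n : minimal_set (M n) by case: (sP n).
have Mv n : M n (v n) by case: (sP n).
have yv n : mdist y (v n) < n.+1%:R^-1 by case: (sP n).
pose u c n := proj (M n) c.
have ucauchy c : C c -> cauchy_seq (u c).
  move=> Cc e e0; have e2 : 0 < e / 2 by rewrite divr_gt0.
  have [N hN] := invn_small e2; exists N => m n Nm Nn.
  apply: le_lt_trans (minimal_proj_gap Cm (Mm m) (Mm n) (Mv m) (Mv n) Cc) _.
  have := metric_triangle (v m) y (v n); rewrite [mdist _ y]metric_sym.
  have := lt_trans (yv m) (hN _ Nm); have := lt_trans (yv n) (hN _ Nn); lra.
have Fex c : exists l, C c -> converges_to (u c) l.
  have [/ucauchy/complX[l ul]|nCc] := pselect (C c); first by exists l.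
  by exists c.
have {Fex}[F uF] := choice Fex.
have Fiso : isometric_on C F.
  move=> c c' Cc Cc'.
  have eqd : forall e, 0 < e -> `|mdist (F c) (F c') - mdist c c'| < e.
    move=> e e0; have e2 : 0 < e / 2 by rewrite divr_gt0.
    have [N1 h1] := uF _ Cc _ e2; have [N2 h2] := uF _ Cc' _ e2.
    have {}h1 := h1 _ (leq_maxl N1 N2); have {}h2 := h2 _ (leq_maxr N1 N2).
    set n := maxn N1 N2 in h1 h2.
    have dn : mdist (u c n) (u c' n) = mdist c c' by exact: (minimal_proj_iso Cm).
    have := metric_triangle (F c) (u c n) (F c').
    have := metric_triangle (u c n) (u c' n) (F c').
    have := metric_triangle (u c n) (F c) (u c' n).
    have := metric_triangle (F c) (F c') (u c' n).
    rewrite dn [mdist (F c) (u c n)]metric_sym [mdist (F c') (u c' n)]metric_sym.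
    by rewrite ltr_norml => *; apply/andP; split; lra.
  apply/eqP; rewrite -subr_eq0 -normr_eq0; apply/eqP/le_anti/andP; split=> //.
  by apply/ler_addgt0Pr => e e0; rewrite add0r ltW// eqd.
have Fequi : equivariant_on C F.
  move=> g c Cc; have Cgc : C (act g c) by case: Cm => _ _ Ci _; exact: Ci.
  apply: eq_mdist_small => e e0; have e2 : 0 < e / 2 by rewrite divr_gt0.
  have [N1 h1] := uF _ Cc _ e2; have [N2 h2] := uF _ Cgc _ e2.
  have {}h1 := h1 _ (leq_maxl N1 N2); have {}h2 := h2 _ (leq_maxr N1 N2).
  set n := maxn N1 N2 in h1 h2.
  have := metric_triangle (F (act g c)) (u (act g c) n) (act g (F c)).
  rewrite [mdist (F _) (u _ _)]metric_sym.
  rewrite {2}/u proj_minimal_equivariant// act_iso -/(u c n); lra.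
exists (F @` C); first exact: minimal_image.
pose c := proj C y; have Cc : C c by exact: minimal_proj_in.
exists c => //; apply/esym; apply: eq_mdist_small => e e0.
have e3 : 0 < e / 3 by rewrite divr_gt0.
have [N1 h1] := uF _ Cc _ e3; have [N2 h2] := invn_small e3.
have {}h1 := h1 _ (leq_maxl N1 N2); have {}h2 := h2 _ (leq_maxr N1 N2).
set n := maxn N1 N2 in h1 h2; have yvn := lt_trans (yv n) h2.
have vu : mdist (v n) (u c n) <= mdist y (v n).
  have Cv : C (proj C (v n)) by exact: minimal_proj_in.
  rewrite -{1}(minimal_projK (Mm n) Cm (Mv n)).
  have -> := minimal_proj_iso Cm (Mm n) Cv Cc.
  rewrite [leRHS]metric_sym.
  by case: (Cm) => C0 Ccc _ _; exact: (proj_lip complX C0 Ccc).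
have := metric_triangle y (v n) (F c).
have := metric_triangle (v n) (u c n) (F c); lra.
Qed.

Lemma closed_convex_hullP A : closed_convex (closed_convex_hull A).
Proof.
split; first by apply: closed_bigI => C [[]].
move=> x y t hx hy t01 C CA; have [[_ /(geoconvexP catX) Ccv] _] := CA.
by apply: Ccv => //; [exact: hx|exact: hy].
Qed.

(** The hull of an orbit is itself invariant, since translates of closed convex
    sets are closed and convex; hence it competes with [M]. *)
Lemma minimal_hull M x : minimal_set M -> M x ->
  closed_convex_hull (orbit_set act x) = M.
Proof.
move=> [_ Mcc Mi Mmin] Mx; apply/seteqP; split.
  apply: smallest_sub => [|_ [g _ <-]]; last exact: Mi.
  by split; [exact: Mcc.1|apply/(geoconvexP catX); exact: Mcc.2].
have hx : closed_convex_hull (orbit_set act x) x.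
  by apply: sub_gen_smallest; exists 1%g.
apply: Mmin; first by exists x.
- exact: closed_convex_hullP.
- move=> g y hy C [[Ccl Ccv] xC].
  suff [] : ([set C | closed C /\ geodesically_convex C] (act g @^-1` C) /\
      orbit_set act x `<=` act g @^-1` C).
    by move=> h1 h2; exact: (hy _ (conj h1 h2)).
  split; last by move=> _ [h _ <-]; apply: xC; exists (g * h)%g => //; rewrite actM.
  split.
    apply/closed_mdistP => z zC; move/closed_mdistP: Ccl; apply => e e0.
    by have [w Cw zw] := zC _ e0; exists (act g w) => //; rewrite act_iso.
  apply/(geoconvexP catX) => z w t Cz Cw t01.
  by rewrite /= act_geopt//; move/(geoconvexP catX): Ccv; exact.
- apply: smallest_sub => [|_ [g _ <-]]; last exact: Mi.
  by split; [exact: Mcc.1|apply/(geoconvexP catX); exact: Mcc.2].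
Qed.

(** Zorn's lemma, applied to the invariant closed convex sets that meet the
    compact fundamental domain [K]. *)
Lemma minimal_ex (C0 : set X) : C0 !=set0 -> closed_convex C0 ->
  cocompact_on act C0 -> exists2 M, minimal_set M & M `<=` C0.
Proof.
move=> [c0 Cc0] C0cc [K [Kc KC0 CK]].
have C0i : invariant_set act C0.
  move=> g x; rewrite -CK => -[h _ [k Kk <-]].
  by exists (g * h)%g => //; exists k; rewrite ?actM.
have meetK N : N !=set0 -> invariant_set act N -> N `<=` C0 -> N `&` K !=set0.
  move=> [x Nx] Ni NC; have := NC _ Nx; rewrite -CK => -[g _ [k Kk kx]].
  by exists k; split=> //; rewrite -(actK g k) kx; exact: Ni.
pose good N := [/\ closed_convex N, invariant_set act N & N `&` K !=set0].
have [B [Bgood Bmax]] : exists B, good (~` B) /\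
    forall B', B `<` B' -> ~ good (~` B').
  apply: (@Zorn_bigcup _ [set B | good (~` B)]) => D Dgood Dtot.
  rewrite /= setC_bigcup.
  have [->|D0] := eqVneq D set0.
    rewrite bigcap_set0; split=> //.
    by rewrite setTI; have [k []] := meetK C0 (ex_intro _ c0 Cc0) C0i (fun=> id);
      exists k.
  have [B0 DB0] : D !=set0 by apply/set0P.
  split.
  - split; first by apply: closed_bigI => B /Dgood[[]].
    move=> x y t Dx Dy t01 B DB; have [[_ Bcv] _ _] := Dgood _ DB.
    by apply: Bcv => //; [exact: Dx|exact: Dy].
  - by move=> g x Dx B DB; have [_ Bi _] := Dgood _ DB; apply: Bi; exact: Dx.
  - pose F := filter_from D (fun B => ~` B `&` K).
    have Ff : ProperFilter F.
      apply: filter_from_proper; last by move=> B /Dgood[].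
      apply: filter_from_filter => [|A B DA DB]; first by exists B0.
      have [AB|BA] := Dtot _ _ DA DB.
        by exists B => // x [nBx Kx]; split; split=> // Ax; exact/nBx/AB.
      by exists A => // x [nAx Kx]; split; split=> // Bx; exact/nAx/BA.
    have FK : F K by exists B0 => // x [].
    have [x [Kx clx]] := Kc F Ff FK.
    exists x; split=> // B DB; have [[Bcl _] _ _] := Dgood _ DB.
    apply: Bcl => U Ux; have FB : F (~` B) by exists B => // z [].
    exact: clx FB Ux.
have [Bcc Bi [k [Bk Kk]]] := Bgood; pose M := ~` B `&` C0.
exists M; last by move=> x [].
have MB : M = ~` B.
  apply/seteqP; split=> [x []//|x nBx]; split=> //; apply: contrapT => nC0x.
  apply: (Bmax (~` M)); last first.
    rewrite setCK; split; [exact: closed_convexI|exact: invariant_setI|].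
    by exists k; split=> //; split=> //; exact: KC0.
  by split=> [z Bz []//|/(_ x)]; rewrite /= => h; apply/nBx/h => -[_ /nC0x].
split.
- by exists k; split=> //; exact: KC0.
- exact: closed_convexI.
- exact: invariant_setI.
- move=> N N0 Ncc Ni NM x Mx; apply: contrapT => nNx.
  apply: (Bmax (~` N)); last first.
    by rewrite setCK; split=> //; apply: meetK => // z /NM[].
  split=> [z Bz /NM[]//|]; rewrite MB in Mx.
  by move=> /(_ x nNx).
Qed.

(** * The product decomposition *)

Section Splitting.
Variables (C : set X) (c0 : X).
Hypotheses (Cm : minimal_set C) (Cc0 : C c0).

(** The minimal set through [z], when there is one. *)
Definition leaf z : set X := closed_convex_hull (orbit_set act z).

Lemma leafP z : minimal_union z -> minimal_set (leaf z) /\ leaf z z.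
Proof. by move=> [M Mm Mz]; rewrite /leaf (minimal_hull Mm Mz). Qed.

(** The fibre of [proj C] over [c0] meets every minimal set exactly once: it is
    the second factor of the decomposition, the first one being [C]. *)
Definition transversal := [set z | minimal_union z /\ proj C z = c0].

Lemma transversal_base : transversal c0.
Proof.
have [C0 Ccc _ _] := Cm.
by split; [exists C|exact: (proj_id complX C0 Ccc Cc0)].
Qed.

Lemma proj_leaf z : transversal z -> proj (leaf z) c0 = z.
Proof.
move=> [Zz <-]; have [Lm Lz] := leafP Zz; exact: (minimal_projK Lm Cm Lz).
Qed.

Lemma leaf_transversal y : minimal_union y ->
  transversal (proj (leaf y) c0) /\ leaf (proj (leaf y) c0) = leaf y.
Proof.
move=> /leafP[Lm Ly]; have Lp := minimal_proj_in Lm c0.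
split; last exact: minimal_hull Lm Lp.
by split; [exists (leaf y)|exact: (minimal_projK Cm Lm Cc0)].
Qed.

Definition split_map (u : metric_sub C * metric_sub transversal) : X :=
  proj (leaf (sval u.2)) (sval u.1).

Definition split_inv (x : X) : metric_sub C * metric_sub transversal :=
  (into_sub (exist _ c0 (mem_set Cc0) : metric_sub C) (proj C x),
   into_sub (exist _ c0 (mem_set transversal_base) : metric_sub transversal)
     (proj (leaf x) c0)).

Lemma split_inv1 x : sval (split_inv x).1 = proj C x.
Proof. by rewrite into_subK//; exact: minimal_proj_in. Qed.

Lemma split_inv2 x : minimal_union x ->
  sval (split_inv x).2 = proj (leaf x) c0.
Proof. by move=> Zx; rewrite into_subK//; have [] := leaf_transversal Zx. Qed.

Lemma split_invK x : minimal_union x -> split_map (split_inv x) = x.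
Proof.
move=> Zx; rewrite /split_map split_inv1 split_inv2//.
have [_ ->] := leaf_transversal Zx; have [Lm Lx] := leafP Zx.
exact: (minimal_projK Lm Cm Lx).
Qed.

Lemma split_map_leaf u : leaf (sval u.2) (split_map u).
Proof.
have [Zu _] := metric_subP u.2; have [Lm _] := leafP Zu.
exact: minimal_proj_in.
Qed.

Lemma split_mapK : cancel split_map split_inv.
Proof.
move=> [c z]; have [Zz pz] := metric_subP z; have [Lm Lz] := leafP Zz.
have Cc := metric_subP c; have Lu := @split_map_leaf (c, z).
rewrite [RHS]surjective_pairing [LHS]surjective_pairing; congr (_, _).
  by apply: val_inj; rewrite /= split_inv1; exact: (minimal_projK Cm Lm Cc).
apply: val_inj; rewrite /= split_inv2; last by exists (leaf (sval z)).
by rewrite /leaf (minimal_hull Lm Lu); exact: proj_leaf.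
Qed.

(** The Pythagorean identity for the leaves of [z] and [z']: the gap between them
    is [mdist z z'], because [z] and [z'] are the projections of the same point
    [c0] and projections compose. *)
Lemma split_map_isometry u v : mdist (split_map u) (split_map v) = l2_dist u v.
Proof.
case: u v => [c z] [c' z']; rewrite /l2_dist /split_map /= !mdist_subE.
have Cc := metric_subP c; have Cc' := metric_subP c'.
have Tz := metric_subP z; have Tz' := metric_subP z'.
case: (Tz) => Zz pz; case: (Tz') => Zz' _.
have [Lm Lz] := leafP Zz; have [Lm' _] := leafP Zz'.
apply/esym/sqrt_eq; first exact: mdist_ge0.
rewrite -(minimal_proj_comp Cm Lm Lm' Cc').
rewrite (minimal_pythagoras Lm Lm')//; try exact: minimal_proj_in.
rewrite (minimal_proj_iso Cm Lm Cc Cc') addrC.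
have zz' : proj (leaf (sval z')) (sval z) = sval z'.
  by rewrite -{1}(proj_leaf Tz) (minimal_proj_comp Cm Lm Lm' Cc0) proj_leaf.
by rewrite (gap_constant Lm Lm' (minimal_proj_in Lm _) Lz) zz'.
Qed.

Lemma split_map_splitting : product_splitting minimal_union split_map split_inv.
Proof.
split; [exact: split_map_isometry| |exact: split_mapK].
apply/seteqP; split=> [_ [u _ <-]|x Zx].
  have [Zu _] := metric_subP u.2; have [Lm _] := leafP Zu.
  by exists (leaf (sval u.2)) => //; exact: split_map_leaf.
by exists (split_inv x) => //; exact: split_invK.
Qed.

Lemma slice_split_map (z : metric_sub transversal) : slice split_map z = leaf (sval z).
Proof.
have [Zz _] := metric_subP z; have [Lm Lz] := leafP Zz.
apply/seteqP; split=> [_ [c _ <-]|x Lx].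
  exact: (@split_map_leaf (c, z)).
have Cp : C (proj C x) by exact: minimal_proj_in.
exists (exist _ (proj C x) (mem_set Cp)) => //.
exact: (minimal_projK Lm Cm Lx).
Qed.

Lemma split_inv2_eq M x y : minimal_set M -> M x -> M y ->
  (split_inv x).2 = (split_inv y).2.
Proof.
move=> Mm Mx My; apply: val_inj; rewrite /= !split_inv2; try by exists M.
by rewrite /leaf (minimal_hull Mm Mx) (minimal_hull Mm My).
Qed.

Lemma split_inv2_lip x y : minimal_union x -> minimal_union y ->
  mdist (split_inv x).2 (split_inv y).2 <= mdist x y.
Proof.
move=> Zx Zy; rewrite -{2}(split_invK Zx) -{2}(split_invK Zy) split_map_isometry.
rewrite /l2_dist -[leLHS]ger0_norm ?mdist_ge0// -sqrtr_sqr ler_sqrt.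
  by rewrite lerDr sqr_ge0.
by rewrite addr_ge0 ?sqr_ge0.
Qed.

Lemma mdist_split_map2 c (z z' : metric_sub transversal) :
  mdist (split_map (c, z)) (split_map (c, z')) = mdist z z'.
Proof.
rewrite split_map_isometry /l2_dist /= mdistxx expr0n/= add0r.
by rewrite sqrtr_sqr ger0_norm ?mdist_ge0.
Qed.

End Splitting.

(** The projection from [C] onto [M] is an equivariant isometry, so it carries a
    compact fundamental domain of [C] to one of [M]. *)
Lemma minimal_cocompact C M : minimal_set C -> minimal_set M ->
  cocompact_on act C -> cocompact_on act M.
Proof.
move=> Cm Mm [K [Kc KC CK]]; have [M0 Mcc Mi _] := Mm.
have pin := minimal_proj_in Mm.
exists (proj M @` K); split.
- by apply: compact_short_image => // x y _ _; exact: (proj_lip complX M0 Mcc).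
- by move=> _ [k _ <-].
apply/seteqP; split=> [_ [g _ [_ [k _ <-] <-]]|x Mx]; first exact/Mi/pin.
have [g _ [k Kk gk]] : (\bigcup_(g in [set: H]) (act g @` K)) (proj C x).
  by rewrite CK; exact: minimal_proj_in.
exists g => //.
exists (proj M k); first by exists k.
by rewrite -(proj_minimal_equivariant Mm) gk; exact: (minimal_projK Mm Cm Mx).
Qed.

End Minimal.

(** * Actions of a product of two groups *)

Lemma mulg_pair (G1 G2 : groupType) (a c : G1) (b d : G2) :
  ((a, b) * (c, d))%g = (a * c, b * d)%g.
Proof. by []. Qed.

Section ProductAction.
Context {R : realType} {G1 G2 : groupType} {X : metricType R}.
Variable act : G1 * G2 -> X -> X.
Hypotheses (catX : CAT0 X) (geom : geometric_action_on act [set: X]).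
Implicit Types (x y z : X) (M : set X).

Local Notation actl := (act_left act).
Local Notation actr := (act_right act).
Local Notation Z := (minimal_union catX actl).

Let complX : sequentially_complete X := geometric_complete geom.
Let act1 x : act 1%g x = x. Proof. exact: geometric_act1 geom _ I. Qed.
Let actM g h x : act (g * h)%g x = act g (act h x).
Proof. exact: geometric_actM geom _ _ _ I. Qed.
Let act_iso g x y : mdist (act g x) (act g y) = mdist x y.
Proof. exact: geometric_isometric geom _ _ _ I I. Qed.

Let actl1 x : actl 1%g x = x. Proof. exact: act1. Qed.
Let actlM g h x : actl (g * h)%g x = actl g (actl h x).
Proof. by rewrite /act_left -actM mulg_pair mulg1. Qed.
Let actl_iso g x y : mdist (actl g x) (actl g y) = mdist x y.
Proof. exact: act_iso. Qed.
Let actr1 x : actr 1%g x = x. Proof. exact: act1. Qed.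
Let actrM g h x : actr (g * h)%g x = actr g (actr h x).
Proof. by rewrite /act_right -actM mulg_pair mulg1. Qed.

Lemma act_leftr g x : act g x = actl g.1 (actr g.2 x).
Proof. by rewrite /act_left /act_right -actM mulg_pair mulg1 mul1g; case: g. Qed.

Lemma act_rightl g x : act g x = actr g.2 (actl g.1 x).
Proof. by rewrite /act_left /act_right -actM mulg_pair mulg1 mul1g; case: g. Qed.

Lemma act_left_right g h x : actl g (actr h x) = actr h (actl g x).
Proof. by rewrite -(act_leftr (g, h)) -(act_rightl (g, h)). Qed.

(** [G2] permutes the minimal sets of [G1], because it commutes with [G1]. *)
Lemma act_right_minimal h M :
  minimal_set catX actl M -> minimal_set catX actl (actr h @` M).
Proof.
move=> Mm; apply: minimal_image => //; first by move=> x y _ _; exact: act_iso.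
by move=> g x _; rewrite act_left_right.
Qed.

Lemma act_right_union h x : Z x -> Z (actr h x).
Proof.
by move=> [M Mm Mx]; exists (actr h @` M); [exact: act_right_minimal|exists x].
Qed.

Lemma minimal_union_invariant : invariant_set act Z.
Proof.
move=> g x /(act_right_union g.2)[M Mm Mx]; rewrite act_leftr.
by exists M => //; case: Mm => _ _ Mi _; exact: Mi.
Qed.

Lemma invariant_quasi_dense (A : set X) :
  A !=set0 -> invariant_set act A -> quasi_dense A.
Proof.
move=> [a Aa] Ai; have [K [Kc _ KX]] := geometric_cocompact geom.
have [N hN] := compact_bounded a Kc.
exists (`|N| + 1) => [|x]; first by rewrite ltr_wpDl.
have : [set: X] x by []; rewrite -KX => -[g _ [k Kk <-]].
exists (act g a); first exact: Ai.
by rewrite act_iso (le_trans (hN _ Kk))// (le_trans (ler_norm N))// lerDl.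
Qed.

Lemma act_left_geometric M : minimal_set catX actl M -> cocompact_on actl M ->
  geometric_action_on actl M.
Proof.
move=> [_ _ Mi _] Mc; split=> //.
move=> x Mx; have [r r0 fin] := geometric_proper geom (x := x) I.
exists r => //; apply: sub_finite_set (finite_image fst fin) => g /=.
move=> [y [[w [xw _] wy] [xy _]]]; exists (g, 1%g) => //.
by exists y; split; [exists w|].
Qed.

Section RightAction.
Variables (C : set X) (c0 : X).
Hypotheses (Cm : minimal_set catX actl C) (Cc0 : C c0).
Hypothesis Cc : cocompact_on actl C.

Local Notation X1 := (metric_sub C).
Local Notation X2 := (metric_sub (transversal catX actl C c0)).
Local Notation f := (split_map (catX := catX) (act := actl) (C := C) (c0 := c0)).
Local Notation p := (split_inv complX Cm Cc0).

Let fp x : Z x -> f (p x) = x.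
Proof. exact: split_invK. Qed.
Let pf : cancel f p. Proof. exact: split_mapK. Qed.
Let Zf u : Z (f u).
Proof.
have [_ fZ _] := split_map_splitting complX actl1 actlM actl_iso Cm Cc0.
by rewrite -fZ; exists u.
Qed.
Let p2_eq M x y : minimal_set catX actl M -> M x -> M y -> (p x).2 = (p y).2.
Proof. exact: split_inv2_eq. Qed.
Let p2_lip x y : Z x -> Z y -> mdist (p x).2 (p y).2 <= mdist x y.
Proof. exact: split_inv2_lip. Qed.
Let mdist_f2 c (z z' : X2) : mdist (f (c, z)) (f (c, z')) = mdist z z'.
Proof. exact: mdist_split_map2. Qed.

Let f_leaf u : leaf actl (sval u.2) (f u).
Proof. exact: (@split_map_leaf _ _ _ _ complX _ actl1 actlM actl_iso). Qed.

(** Both points lie in the image under [actr h] of the leaf of [x], which is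
    again minimal. *)
Let p2_actr h c x : Z x -> (p (actr h (f (c, (p x).2)))).2 = (p (actr h x)).2.
Proof.
move=> Zx; have [Zq _] := metric_subP (p x).2.
have [Lm _] := leafP actl1 actlM actl_iso Zq.
apply: (p2_eq (act_right_minimal h Lm)).
  by exists (f (c, (p x).2)) => //; exact: (@f_leaf (c, (p x).2)).
by exists x => //; rewrite -[X in leaf _ _ X](fp Zx); exact: (@f_leaf (p x)).
Qed.

Let p2_actl g x : Z x -> (p (actl g x)).2 = (p x).2.
Proof.
by move=> [M Mm Mx]; apply: (p2_eq Mm) => //; case: Mm => _ _ Mi _; exact: Mi.
Qed.

Variable c : X1.
Local Notation star := (projected_action actr f p c).

Let star_p h x : Z x -> star h (p x).2 = (p (actr h x)).2.
Proof. exact: p2_actr. Qed.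

Let star1 (z : X2) : star 1%g z = z.
Proof. by rewrite /projected_action actr1 pf. Qed.

Let starM g h (z : X2) : star (g * h)%g z = star g (star h z).
Proof.
rewrite /projected_action actrM -/(star g _).
by rewrite -star_p//; exact/act_right_union/Zf.
Qed.

Let star_lip g (z z' : X2) : mdist (star g z) (star g z') <= mdist z z'.
Proof.
apply: le_trans (p2_lip (act_right_union _ (Zf _)) (act_right_union _ (Zf _))) _.
by rewrite act_iso mdist_f2.
Qed.

(** The inverse of [star g] is 1-Lipschitz as well. *)
Let star_iso g (z z' : X2) : mdist (star g z) (star g z') = mdist z z'.
Proof.
apply/eqP; rewrite eq_le star_lip /= -{1}(star1 z) -{1}(star1 z') -(mulVg g).
by rewrite !starM star_lip.
Qed.

(** If [star g z] is close to [z], then some element of [G1] brings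
    [act (1, g) (f (c, z))] close to a fixed compact subset of the slice of [z];
    properness of the whole action leaves finitely many such [g]. *)
Let star_proper : proper_on star [set: X2].
Proof.
move=> z _; have [K [Kc KC CK]] := Cc.
have Tz := metric_subP z; have [Lm Lz] := leafP actl1 actlM actl_iso Tz.1.
have K'c : compact (proj (leaf actl (sval z)) @` K).
  have [L0 Lcc _ _] := Lm.
  by apply: compact_short_image => // x y _ _; exact: (proj_lip complX L0 Lcc).
have [e e0 fin] := proper_compact geom (f (c, z)) K'c.
exists (e / 2); first by rewrite divr_gt0.
apply: sub_finite_set (finite_image snd fin) => g [_ [[w [zw _] <-] [zgw _]]].
move: zw zgw; rewrite !ballEmdist /= => zw zgw.
have gz : mdist (star g z) z < e.
  have := metric_triangle (star g z) (star g w) z.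
  by rewrite star_iso [mdist (star g w) z]metric_sym; lra.
have Zy := act_right_union g (Zf (c, z)).
have [h _ [k Kk hk]] :
    (\bigcup_(h in [set: G1]) (actl h @` K)) (sval (p (actr g (f (c, z)))).1).
  by rewrite CK; exact: metric_subP.
exists (h^-1%g, g) => //=.
exists (proj (leaf actl (sval z)) k); first by exists k.
have Ck := KC _ Kk; pose k' : X1 := exist _ k (mem_set Ck).
suff -> : act (h^-1%g, g) (f (c, z)) = f (k', star g z).
  by rewrite -[X in mdist _ X]/(f (k', z)) mdist_f2.
rewrite act_leftr /= -[in LHS](fp Zy) -/(star g z).
have [L'm _] := leafP actl1 actlM actl_iso (metric_subP (star g z)).1.
rewrite /split_map /= -(proj_minimal_equivariant complX actl1 actlM actl_iso L'm).
by rewrite -hk (actK actl1 actlM).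
Qed.

(** The second coordinates of a compact fundamental domain of the minimal union
    form a fundamental domain, as [G1] preserves second coordinates. *)
Let star_cocompact : cocompact_on star [set: X2].
Proof.
have [K [Kc _ KX]] := geometric_cocompact geom.
have KZc : compact (K `&` Z).
  by apply: compact_closedI => //; exact: minimal_union_closed.
exists ((fun x => (p x).2) @` (K `&` Z)); split=> //.
  by apply: compact_short_image => // x y [_ Zx] [_ Zy]; exact: p2_lip.
apply/seteqP; split=> // z _.
have [g _ [k Kk gk]] : (\bigcup_(g in [set: G1 * G2]) (act g @` K)) (f (c, z)).
  by rewrite KX.
have Zk : Z k.
  by rewrite -(actK act1 actM g k) gk; exact/minimal_union_invariant/Zf.
exists g.2 => //; exists (p k).2; first by exists k.
by rewrite star_p// -(p2_actl g.1 (act_right_union g.2 Zk)) -act_leftr gk pf.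
Qed.

Lemma projected_action_geometric : geometric_action_on star [set: X2].
Proof. by split. Qed.

End RightAction.

End ProductAction.

Theorem theorem1 (R : realType) (G1 G2 : groupType) (X : metricType R)
    (act : G1 * G2 -> X -> X) (x0 : X) :
  CAT0 X ->
  geometric_action_on act [set: X] ->
  cocompact_on (act_left act)
    (closed_convex_hull (orbit_set (act_left act) x0)) ->
  exists X' : set X,
    [/\ closed X', geodesically_convex X', invariant_set act X',
        quasi_dense X' &
        exists (X1 X2 : metricType R) (f : X1 * X2 -> X) (p : X -> X1 * X2),
          [/\ product_splitting X' f p,
              forall x2 : X2,
                geometric_action_on (act_left act) (slice f x2),
              forall x1 : X1,
                geometric_action_on
                  (projected_action (act_right act) f p x1) [set: X2] &
              forall x2 : X2, exists x : X,
                slice f x2 =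
                closed_convex_hull (orbit_set (act_left act) x)]].
Proof.
move=> catX geom C0c; pose complX := geometric_complete geom.
set L := act_left act in C0c *.
have L1 x : L 1%g x = x by exact: geometric_act1 geom _ I.
have LM g h x : L (g * h)%g x = L g (L h x).
  by rewrite /L /act_left -(geometric_actM geom)// mulg_pair mulg1.
have Liso g x y : mdist (L g x) (L g y) = mdist x y.
  exact: geometric_isometric geom _ _ _ I I.
set C0 := closed_convex_hull _ in C0c.
have C0x : C0 x0 by apply: sub_gen_smallest; exists 1%g.
have [C Cm CC0] := minimal_ex L1 LM (ex_intro _ _ C0x)
  (closed_convex_hullP catX _) C0c.
have [[c0 Cc0] Ccc Ci _] := Cm.
have Cc : cocompact_on L C.
  have [K [Kc KC0 KX]] := C0c; exists (K `&` C); split.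
  - by apply: compact_closedI => //; exact: Ccc.1.
  - by move=> x [].
  apply/seteqP; split=> [_ [g _ [k [_ Ck] <-]]|x Cx]; first exact: Ci.
  have [g _ [k Kk gk]] : (\bigcup_(g in [set: G1]) (L g @` K)) x.
    by rewrite KX; exact: CC0.
  by exists g => //; exists k => //; split=> //; rewrite -(actK L1 LM g k) gk; exact: Ci.
have Zinv := minimal_union_invariant (catX := catX) geom.
have slice_leaf := slice_split_map complX L1 LM Liso (c0 := c0) Cm.
exists (minimal_union catX L); split => //.
- exact: minimal_union_closed.
- by apply/(geoconvexP catX); exact: minimal_union_convex.
- by apply: (invariant_quasi_dense geom) => //; exists c0; exists C.
exists (metric_sub C), (metric_sub (transversal catX L C c0)).
exists (split_map (c0 := c0)), (split_inv complX Cm Cc0).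
split.
- exact: split_map_splitting.
- move=> z; rewrite slice_leaf.
  have [Lm Lz] := leafP L1 LM Liso (metric_subP z).1.
  apply: (act_left_geometric geom Lm).
  exact: (minimal_cocompact complX L1 LM Liso Cm Lm Cc).
- by move=> c; exact: (projected_action_geometric geom Cm Cc0 Cc).
- by move=> z; exists (sval z); rewrite slice_leaf.
Qed.
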